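(* Let $\lambda$ be an infinite regular cardinal and let $\mathcal{A}$ be a Grothendieck category with enough projective objects. Then there is an equivalence $$\mathbf{K}_{ac}^{-}(\mathcal{PP}_\lambda)\simeq \mathbf{K}_{ac}^{-}(\mathcal{A})/\mathbf{K}_{\lambda}^{-}(\mathcal{A}).$$ Moreover, there are equivalences $$\mathbf{D}^{-}(\mathcal{A})\simeq \mathbf{K}^{-}(\mathcal{PP}_\lambda)/\mathbf{K}_{ac}^{-}(\mathcal{PP}_\lambda)\simeq \mathbf{D}_{\lambda}^{-}(\mathcal{A})/\mathbf{K}_{ac}^{-}(\mathcal{PP}_\lambda).$$
   Context: Complexes are cochain complexes. $\mathbf{K}(\mathcal{A})$ is the homotopy category of complexes over $\mathcal{A}$ and $\mathbf{K}^{-}(\mathcal{A})$ its full subcategory of bounded above complexes. An object $F$ of $\mathcal{A}$ is $\lambda$-presentable if $\mathrm{Hom}_{\mathcal{A}}(F,-)$ commutes with $\lambda$-directed colimits. A short exact sequence $\xi$ in $\mathcal{A}$ is $\lambda$-pure if $\mathrm{Hom}_{\mathcal{A}}(F,\xi)$ is exact for every $\lambda$-presentable $F$. An object is $\lambda$-pure projective if it is projective with respect to all $\lambda$-pure short exact sequences; $\mathcal{PP}_\lambda$ is the class of all $\lambda$-pure projective objects. A complex $X$ is $\lambda$-pure acyclic if the complex $\mathrm{Hom}_{\mathcal{A}}(P,X)$ is acyclic for every $\lambda$-presentable (more generally, $\lambda$-pure projective) object $P$. $\mathbf{K}_{\lambda}^{-}(\mathcal{A})$ (resp. $\mathbf{K}_{ac}^{-}(\mathcal{A})$)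 is the full subcategory of $\mathbf{K}^{-}(\mathcal{A})$ of $\lambda$-pure acyclic (resp. acyclic) complexes. $\mathbf{K}^{-}(\mathcal{PP}_\lambda)$ is the full subcategory of $\mathbf{K}^-(\mathcal{A})$ of bounded above complexes with all terms in $\mathcal{PP}_\lambda$, and $\mathbf{K}_{ac}^{-}(\mathcal{PP}_\lambda)$ its full subcategory of acyclic complexes. $\mathbf{D}^{-}(\mathcal{A})=\mathbf{K}^{-}(\mathcal{A})/\mathbf{K}_{ac}^{-}(\mathcal{A})$ is the usual bounded above derived category, and $\mathbf{D}_{\lambda}^{-}(\mathcal{A})=\mathbf{K}^{-}(\mathcal{A})/\mathbf{K}_{\lambda}^{-}(\mathcal{A})$ the bounded above $\lambda$-pure derived category; all quotients are Verdier quotients. In the last quotient, $\mathbf{K}_{ac}^{-}(\mathcal{PP}_\lambda)$ is identified with its image under the canonical triangle equivalence $\mathbf{K}^{-}(\mathcal{PP}_\lambda)\simeq\mathbf{D}_{\lambda}^{-}(\mathcal{A})$. *)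

(* Defs.v *)
From HB Require Import structures.
From Stdlib Require Import RelationClasses.
From mathcomp Require Import all_boot all_order all_algebra.
From mathcomp Require Import boolp classical_sets functions cardinality.

Set Implicit Arguments.
Unset Strict Implicit.
Unset Printing Implicit Defensive.

Import Order.TTheory GRing.Theory Num.Theory.
Local Open Scope card_scope.
Local Open Scope ring_scope.

(* The universe of "sets".  Index sets of coproducts and of directed systems,
   cardinals and (see [lpresentable]) Hom groups are small; the objects of a
   category live in an unrelated, possibly larger, universe. *)
Definition small := Type.

Definition card_lt (T U : Type) (A : set T) (B : set U) : Prop :=
  (A #<= B) /\ ~ (B #<= A).

(* A cardinal is given by a set of that cardinality.  It is regular when it is
   not a sum of fewer than [lam] cardinals smaller than [lam]. *)
Definition infinite_regular (lam : small) : Prop :=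
  infinite_set [set: lam] /\
  forall (J : small) (F : J -> small),
    card_lt [set: J] [set: lam] ->
    (forall j, card_lt [set: F j] [set: lam]) ->
    card_lt [set: {j : J & F j}] [set: lam].

Definition is_poset (I : small) (le : I -> I -> Prop) : Prop :=
  [/\ forall i, le i i,
      forall i j k, le i j -> le j k -> le i k
    & forall i j, le i j -> le j i -> i = j].

Definition directed (I : small) (le : I -> I -> Prop) : Prop :=
  [/\ is_poset le, inhabited I
    & forall i j, exists k, le i k /\ le j k].

Definition lam_directed (lam I : small) (le : I -> I -> Prop) : Prop :=
  is_poset le /\
  forall S : set I, card_lt S [set: lam] ->
    exists k, forall i, S i -> le i k.

Reserved Notation "g ∘ f" (at level 40, left associativity).

Record biproduct_data (obj : Type) (hom : obj -> obj -> zmodType)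
    (idm : forall X, hom X X)
    (comp : forall X Y Z, hom Y Z -> hom X Y -> hom X Z) (X Y : obj) :=
  BiproductData {
    bp_obj : obj;
    bp_inl : hom X bp_obj;
    bp_inr : hom Y bp_obj;
    bp_prl : hom bp_obj X;
    bp_prr : hom bp_obj Y;
    bp_ll : comp _ _ _ bp_prl bp_inl = idm X;
    bp_rr : comp _ _ _ bp_prr bp_inr = idm Y;
    bp_lr : comp _ _ _ bp_prl bp_inr = 0;
    bp_rl : comp _ _ _ bp_prr bp_inl = 0;
    bp_id : comp _ _ _ bp_inl bp_prl + comp _ _ _ bp_inr bp_prr = idm bp_obj }.

Record additive_category := AdditiveCategory {
  obj :> Type;
  hom : obj -> obj -> zmodType;
  idm : forall X, hom X X;
  comp : forall X Y Z, hom Y Z -> hom X Y -> hom X Z;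
  compA : forall W X Y Z (h : hom Y Z) (g : hom X Y) (f : hom W X),
    comp h (comp g f) = comp (comp h g) f;
  comp1m : forall X Y (f : hom X Y), comp (idm Y) f = f;
  compm1 : forall X Y (f : hom X Y), comp f (idm X) = f;
  compDl : forall X Y Z (g g' : hom Y Z) (f : hom X Y),
    comp (g + g') f = comp g f + comp g' f;
  compDr : forall X Y Z (g : hom Y Z) (f f' : hom X Y),
    comp g (f + f') = comp g f + comp g f';
  zero_object : exists Z : obj, forall X : obj,
    (forall f : hom X Z, f = 0) /\ (forall f : hom Z X, f = 0);
  biproduct : forall X Y, biproduct_data idm comp X Y }.

Arguments hom {_} X Y.
Arguments idm {_} X.
Arguments comp {_ X Y Z} g f.
Arguments biproduct {_} X Y.
Notation "g ∘ f" := (comp g f).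

Section AbelianNotions.
Variable A : additive_category.
Implicit Types X Y Z : A.

Definition is_zero Z : Prop := forall X,
  (forall f : hom X Z, f = 0) /\ (forall f : hom Z X, f = 0).

Definition mono X Y (f : hom X Y) : Prop :=
  forall T (u v : hom T X), f ∘ u = f ∘ v -> u = v.

Definition epi X Y (f : hom X Y) : Prop :=
  forall T (u v : hom Y T), u ∘ f = v ∘ f -> u = v.

Definition is_kernel X Y (f : hom X Y) K (k : hom K X) : Prop :=
  f ∘ k = 0 /\
  forall T (t : hom T X), f ∘ t = 0 -> exists! u : hom T K, k ∘ u = t.

Definition is_cokernel X Y (f : hom X Y) C (c : hom Y C) : Prop :=
  c ∘ f = 0 /\
  forall T (t : hom Y T), t ∘ f = 0 -> exists! u : hom C T, u ∘ c = t.

Definition short_exact X Y Z (f : hom X Y) (g : hom Y Z) : Prop :=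
  is_kernel g f /\ is_cokernel f g.

(* exactness at [Y]: [f] is an epimorphism onto the kernel of [g] *)
Definition exact_at X Y Z (f : hom X Y) (g : hom Y Z) : Prop :=
  exists K (k : hom K Y) (u : hom X K),
    [/\ is_kernel g k, epi u & f = k ∘ u].

Definition is_coproduct (I : small) (X : I -> A) S (c : forall i, hom (X i) S) :
  Prop := forall T (t : forall i, hom (X i) T),
    exists! u : hom S T, forall i, u ∘ c i = t i.

Record diagram (I : small) (le : I -> I -> Prop) := Diagram {
  dg_obj :> I -> A;
  dg_map : forall i j, le i j -> hom (dg_obj i) (dg_obj j);
  dg_id : forall i (p : le i i), dg_map p = idm (dg_obj i);
  dg_comp : forall i j k (p : le i j) (q : le j k) (r : le i k),
    dg_map q ∘ dg_map p = dg_map r }.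

Definition is_colimit (I : small) (le : I -> I -> Prop) (D : diagram le) C
    (c : forall i, hom (D i) C) : Prop :=
  (forall i j (p : le i j), c j ∘ dg_map D p = c i) /\
  forall T (t : forall i, hom (D i) T),
    (forall i j (p : le i j), t j ∘ dg_map D p = t i) ->
    exists! u : hom C T, forall i, u ∘ c i = t i.

Definition natural (I : small) (le : I -> I -> Prop) (D E : diagram le)
    (f : forall i, hom (D i) (E i)) : Prop :=
  forall i j (p : le i j), f j ∘ dg_map D p = dg_map E p ∘ f i.

Definition is_abelian : Prop :=
  [/\ forall X Y (f : hom X Y), exists K (k : hom K X), is_kernel f k,
      forall X Y (f : hom X Y), exists C (c : hom Y C), is_cokernel f c,
      forall X Y (f : hom X Y), mono f -> exists Z (g : hom Y Z), is_kernel g f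
    & forall X Y (f : hom X Y), epi f ->
        exists Z (g : hom Z X), is_cokernel g f].

Definition has_coproducts : Prop :=
  forall (I : small) (X : I -> A),
    exists S (c : forall i, hom (X i) S), is_coproduct c.

Definition exact_direct_limits : Prop :=
  forall (I : small) (le : I -> I -> Prop), directed le ->
  forall (D1 D2 D3 : diagram le)
    (f : forall i, hom (D1 i) (D2 i)) (g : forall i, hom (D2 i) (D3 i)),
    natural f -> natural g -> (forall i, short_exact (f i) (g i)) ->
  forall C1 C2 C3 (c1 : forall i, hom (D1 i) C1) (c2 : forall i, hom (D2 i) C2)
    (c3 : forall i, hom (D3 i) C3),
    is_colimit c1 -> is_colimit c2 -> is_colimit c3 ->
  forall (f' : hom C1 C2) (g' : hom C2 C3),
    (forall i, f' ∘ c1 i = c2 i ∘ f i) -> (forall i, g' ∘ c2 i = c3 i ∘ g i) ->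
    short_exact f' g'.

Definition is_generator (G : A) : Prop :=
  forall X Y (f g : hom X Y), f <> g -> exists h : hom G X, f ∘ h <> g ∘ h.

Definition grothendieck : Prop :=
  [/\ is_abelian, has_coproducts, exact_direct_limits
    & exists G, is_generator G].

Definition projective P : Prop :=
  forall X Y (g : hom X Y), epi g ->
  forall h : hom P Y, exists h' : hom P X, g ∘ h' = h.

Definition enough_projectives : Prop :=
  forall X, exists P (p : hom P X), projective P /\ epi p.

End AbelianNotions.

Definition is_set_colimit (I : small) (le : I -> I -> Prop) (S : I -> small)
    (m : forall i j, le i j -> S i -> S j) (C : small) (c : forall i, S i -> C) :
  Prop :=
  (forall i j (p : le i j) x, c j (m i j p x) = c i x) /\
  forall (T : small) (t : forall i, S i -> T),
    (forall i j (p : le i j) x, t j (m i j p x) = t i x) ->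
    exists! u : C -> T, forall i x, u (c i x) = t i x.

Section Purity.
Variables (lam : small) (A : additive_category).
Implicit Types X Y Z P F : A.

(* Hom(F,-), as a functor to sets, preserves lam-directed colimits *)
Definition lpresentable F : Prop :=
  forall (I : small) (le : I -> I -> Prop), lam_directed lam le ->
  forall (D : diagram A le) C (c : forall i, hom (D i) C), is_colimit c ->
    is_set_colimit
      (fun i j (p : le i j) (x : hom F (D i)) => dg_map D p ∘ x : hom F (D j))
      (fun i (x : hom F (D i)) => c i ∘ x : hom F C).

Definition hom_exact F X Y Z (f : hom X Y) (g : hom Y Z) : Prop :=
  [/\ forall x : hom F X, f ∘ x = 0 -> x = 0,
      forall y : hom F Y, g ∘ y = 0 <-> exists x : hom F X, f ∘ x = y
    & forall z : hom F Z, exists y : hom F Y, g ∘ y = z].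

Definition lpure X Y Z (f : hom X Y) (g : hom Y Z) : Prop :=
  short_exact f g /\ forall F, lpresentable F -> hom_exact F f g.

Definition lpure_projective P : Prop :=
  forall X Y Z (f : hom X Y) (g : hom Y Z), lpure f g ->
  forall h : hom P Z, exists h' : hom P Y, g ∘ h' = h.

Lemma lpresentable_pure_projective P : lpresentable P -> lpure_projective P.
Proof. by move=> hP X Y Z f g [_ /(_ _ hP) [_ _ H]] h; apply: H. Qed.

End Purity.

(* Morphisms form setoids, so that homotopy categories and localizations need
   no quotient types: equality of morphisms is the relation [≈]. *)
Record category := Category {
  cobj :> Type;
  chom : cobj -> cobj -> Type;
  ceq : forall X Y, chom X Y -> chom X Y -> Prop;
  cid : forall X, chom X X;
  ccomp : forall X Y Z, chom Y Z -> chom X Y -> chom X Z;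
  ceq_equiv : forall X Y, Equivalence (@ceq X Y);
  ccomp_eq : forall X Y Z (g g' : chom Y Z) (f f' : chom X Y),
    ceq g g' -> ceq f f' -> ceq (ccomp g f) (ccomp g' f');
  ccompA : forall W X Y Z (h : chom Y Z) (g : chom X Y) (f : chom W X),
    ceq (ccomp h (ccomp g f)) (ccomp (ccomp h g) f);
  ccomp1m : forall X Y (f : chom X Y), ceq (ccomp (cid Y) f) f;
  ccompm1 : forall X Y (f : chom X Y), ceq (ccomp f (cid X)) f }.

Arguments chom {_} X Y.
Arguments ceq {_ X Y} f g.
Arguments cid {_} X.
Arguments ccomp {_ X Y Z} g f.

Notation "f ≈ g" := (ceq f g) (at level 70, no associativity).
Notation "g ⊙ f" := (ccomp g f) (at level 40, left associativity).

Section CategoryBasics.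
Variable C : category.
Implicit Types X Y Z : C.

Lemma ceq_refl X Y (f : chom X Y) : f ≈ f.
Proof. by case: (ceq_equiv X Y) => r _ _; apply: r. Qed.
Lemma ceq_sym X Y (f g : chom X Y) : f ≈ g -> g ≈ f.
Proof. by case: (ceq_equiv X Y) => _ s _; apply: s. Qed.
Lemma ceq_trans X Y (f g h : chom X Y) : f ≈ g -> g ≈ h -> f ≈ h.
Proof. by case: (ceq_equiv X Y) => _ _ t; apply: t. Qed.

Lemma ccomp_eql X Y Z (g g' : chom Y Z) (f : chom X Y) :
  g ≈ g' -> g ⊙ f ≈ g' ⊙ f.
Proof. by move=> e; apply: ccomp_eq => //; apply: ceq_refl. Qed.
Lemma ccomp_eqr X Y Z (g : chom Y Z) (f f' : chom X Y) :
  f ≈ f' -> g ⊙ f ≈ g ⊙ f'.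
Proof. by move=> e; apply: ccomp_eq => //; apply: ceq_refl. Qed.

Definition inverses X Y (f : chom X Y) (g : chom Y X) : Prop :=
  g ⊙ f ≈ cid X /\ f ⊙ g ≈ cid Y.
Definition is_iso X Y (f : chom X Y) : Prop := exists g, inverses f g.
Definition isomorphic X Y : Prop := exists f : chom X Y, is_iso f.

Lemma is_iso_id X : is_iso (cid X).
Proof. by exists (cid X); split; apply: ccomp1m. Qed.

Lemma cancel_mid W X Y Z (h : chom Y Z) (g : chom X Y) (g' : chom Y X)
  (f : chom W Y) : g ⊙ g' ≈ cid Y -> (h ⊙ g) ⊙ (g' ⊙ f) ≈ h ⊙ f.
Proof.
move=> e; apply: ceq_trans (ceq_sym (ccompA _ _ _)) _; apply: ccomp_eqr.
apply: ceq_trans (ccompA _ _ _) _; apply: ceq_trans (ccomp_eql _ e) _.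
exact: ccomp1m.
Qed.

Lemma is_iso_comp X Y Z (g : chom Y Z) (f : chom X Y) :
  is_iso g -> is_iso f -> is_iso (g ⊙ f).
Proof.
move=> [g' [g1 g2]] [f' [f1 f2]]; exists (f' ⊙ g'); split.
  by apply: ceq_trans (cancel_mid _ _ g1) f1.
by apply: ceq_trans (cancel_mid _ _ f2) g2.
Qed.

Lemma is_iso_inv X Y (f : chom X Y) (g : chom Y X) : inverses f g -> is_iso g.
Proof. by move=> [h1 h2]; exists f; split. Qed.

End CategoryBasics.

Record functor (C D : category) := Functor {
  fobj :> C -> D;
  fmap : forall X Y, chom X Y -> chom (fobj X) (fobj Y);
  fmap_eq : forall X Y (f g : chom X Y), f ≈ g -> fmap f ≈ fmap g;
  fmap_id : forall X, fmap (cid X) ≈ cid (fobj X);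
  fmap_comp : forall X Y Z (g : chom Y Z) (f : chom X Y),
    fmap (g ⊙ f) ≈ fmap g ⊙ fmap f }.

Arguments fmap {C D} F {X Y} f : rename.

Lemma fmap_is_iso C D (F : functor C D) X Y (f : chom X Y) :
  is_iso f -> is_iso (fmap F f).
Proof.
move=> [g [h1 h2]]; exists (fmap F g); split.
  by apply: ceq_trans (ceq_sym (fmap_comp F _ _)) _;
     apply: ceq_trans (fmap_eq F h1) (fmap_id F _).
by apply: ceq_trans (ceq_sym (fmap_comp F _ _)) _;
   apply: ceq_trans (fmap_eq F h2) (fmap_id F _).
Qed.

Lemma fmap_sq C D (F : functor C D) X Y X' Y' (f : chom X Y) (b : chom Y Y')
  (a : chom X X') (f' : chom X' Y') :
  b ⊙ f ≈ f' ⊙ a -> fmap F b ⊙ fmap F f ≈ fmap F f' ⊙ fmap F a.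
Proof.
move=> e; apply: ceq_trans (ceq_sym (fmap_comp F _ _)) _.
exact: ceq_trans (fmap_eq F e) (fmap_comp F _ _).
Qed.

Definition idF (C : category) : functor C C.
Proof.
by refine (@Functor C C (fun X => X) (fun X Y f => f) _ _ _) => *;
   [ | apply: ceq_refl | apply: ceq_refl].
Defined.

Definition compF (C D E : category) (G : functor D E) (F : functor C D) :
  functor C E.
Proof.
refine (@Functor C E (fun X => G (F X)) (fun X Y f => fmap G (fmap F f)) _ _ _).
- by move=> X Y f g e; do 2 apply: fmap_eq.
- by move=> X; apply: ceq_trans (fmap_eq G (fmap_id F X)) (fmap_id G _).
- move=> X Y Z g f.
  exact: ceq_trans (fmap_eq G (fmap_comp F g f)) (fmap_comp G _ _).
Defined.

Definition nat_iso (C D : category) (F G : functor C D) : Prop :=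
  exists a : forall X, chom (F X) (G X),
    (forall X, is_iso (a X)) /\
    forall X Y (f : chom X Y), a Y ⊙ fmap F f ≈ fmap G f ⊙ a X.

Definition is_equivalence (C D : category) (F : functor C D) : Prop :=
  exists G : functor D C,
    nat_iso (compF G F) (idF C) /\ nat_iso (compF F G) (idF D).

Definition tri_iso (C : category) (S : functor C C)
    X Y Z (f : chom X Y) (g : chom Y Z) (h : chom Z (S X))
    X' Y' Z' (f' : chom X' Y') (g' : chom Y' Z') (h' : chom Z' (S X')) : Prop :=
  exists (a : chom X X') (b : chom Y Y') (c : chom Z Z'),
    [/\ is_iso a, is_iso b & is_iso c] /\
    [/\ b ⊙ f ≈ f' ⊙ a, c ⊙ g ≈ g' ⊙ b & fmap S a ⊙ h ≈ h' ⊙ c].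

(* The data of a triangulated category.  Of the axioms only two are recorded:
   triangles isomorphic to distinguished ones are distinguished, and shifting a
   distinguished triangle gives one up to signs (a triple rotation).  The latter
   makes the shift of a Verdier quotient well defined. *)
Record tri_category := TriCategory {
  tc_cat :> category;
  shift : functor tc_cat tc_cat;
  dist : forall X Y Z : tc_cat,
    chom X Y -> chom Y Z -> chom Z (shift X) -> Prop;
  dist_iso : forall X Y Z (f : chom X Y) (g : chom Y Z) (h : chom Z (shift X))
    X' Y' Z' (f' : chom X' Y') (g' : chom Y' Z') (h' : chom Z' (shift X')),
    tri_iso f g h f' g' h' -> dist f' g' h' -> dist f g h;
  dist_shift : forall X Y Z (f : chom X Y) (g : chom Y Z) (h : chom Z (shift X)),
    dist f g h ->
    exists (g' : chom (shift Y) (shift Z))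
           (h' : chom (shift Z) (shift (shift X))),
      dist (fmap shift f) g' h' }.

Arguments shift {_}.
Arguments dist {_ X Y Z} f g h.

Record tri_functor (T T' : tri_category) := TriFunctor {
  tf_fun :> functor T T';
  tf_comm : forall X, chom (tf_fun (shift X)) (shift (tf_fun X));
  tf_comm_iso : forall X, is_iso (tf_comm X);
  tf_comm_nat : forall X Y (f : chom X Y),
    tf_comm Y ⊙ fmap tf_fun (fmap shift f) ≈
    fmap shift (fmap tf_fun f) ⊙ tf_comm X;
  tf_dist : forall X Y Z (f : chom X Y) (g : chom Y Z) (h : chom Z (shift X)),
    dist f g h ->
    dist (fmap tf_fun f) (fmap tf_fun g) (tf_comm X ⊙ fmap tf_fun h) }.

Definition tri_equivalent (T T' : tri_category) : Prop :=
  exists F : tri_functor T T', is_equivalence F.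

Lemma tri_transport (C : category) (S : functor C C)
    X Y Z X' Y' Z' (f : chom X Y) (f' : chom X' Y') (g' : chom Y' Z')
    (h' : chom Z' (S X')) (a : chom X X') (b : chom Y Y') (c : chom Z Z') :
  is_iso a -> is_iso b -> is_iso c -> b ⊙ f ≈ f' ⊙ a ->
  exists (g : chom Y Z) (h : chom Z (S X)), tri_iso f g h f' g' h'.
Proof.
move=> ia ib ic sq; have [c' [_ c2]] := ic.
have [a' [_ a2]] := fmap_is_iso S ia.
exists (c' ⊙ (g' ⊙ b)), (a' ⊙ (h' ⊙ c)); exists a, b, c; split; split=> //.
  apply: ceq_trans (ccompA _ _ _) _; apply: ceq_trans (ccomp_eql _ c2) _.
  exact: ccomp1m.
apply: ceq_trans (ccompA _ _ _) _; apply: ceq_trans (ccomp_eql _ a2) _.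
exact: ccomp1m.
Qed.

Lemma tri_iso_eq (C : category) (S : functor C C) X Y Z
    (f f' : chom X Y) (g g' : chom Y Z) (h h' : chom Z (S X)) :
  f ≈ f' -> g ≈ g' -> h ≈ h' -> tri_iso f g h f' g' h'.
Proof.
move=> ef eg eh.
exists (cid X), (cid Y), (cid Z); split; first by split; apply: is_iso_id.
split; apply: ceq_trans (ceq_sym (ccompm1 _)).
- exact: ceq_trans (ccomp1m _) ef.
- exact: ceq_trans (ccomp1m _) eg.
- apply: ceq_trans (ccomp_eql _ (fmap_id S _)) _.
  exact: ceq_trans (ccomp1m _) eh.
Qed.

Lemma square_paste (C : category) (X Y X' Y' X'' Y'' : C) (f : chom X Y)
    (f' : chom X' Y') (f'' : chom X'' Y'') (a : chom X X') (b : chom Y Y')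
    (a' : chom X' X'') (b' : chom Y' Y'') :
  b ⊙ f ≈ f' ⊙ a -> b' ⊙ f' ≈ f'' ⊙ a' ->
  (b' ⊙ b) ⊙ f ≈ f'' ⊙ (a' ⊙ a).
Proof.
move=> e e'; apply: ceq_trans (ceq_sym (ccompA _ _ _)) _.
apply: ceq_trans (ccomp_eqr _ e) _; apply: ceq_trans (ccompA _ _ _) _.
apply: ceq_trans (ccomp_eql _ e') _; exact: ceq_sym (ccompA _ _ _).
Qed.

Lemma tri_iso_trans (C : category) (S : functor C C)
    X Y Z (f : chom X Y) (g : chom Y Z) (h : chom Z (S X))
    X' Y' Z' (f' : chom X' Y') (g' : chom Y' Z') (h' : chom Z' (S X'))
    X'' Y'' Z'' (f'' : chom X'' Y'') (g'' : chom Y'' Z'')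
    (h'' : chom Z'' (S X'')) :
  tri_iso f g h f' g' h' -> tri_iso f' g' h' f'' g'' h'' ->
  tri_iso f g h f'' g'' h''.
Proof.
move=> [a [b [c [[ia ib ic] [e1 e2 e3]]]]].
move=> [a' [b' [c' [[ia' ib' ic'] [e1' e2' e3']]]]].
exists (a' ⊙ a), (b' ⊙ b), (c' ⊙ c); split; first by split; apply: is_iso_comp.
split; [exact: square_paste e1 e1' | exact: square_paste e2 e2' |].
apply: ceq_trans (ccomp_eql _ (fmap_comp S _ _)) _.
exact: square_paste e3 e3'.
Qed.

Definition comp_tri (T1 T2 T3 : tri_category) (G : tri_functor T2 T3)
  (F : tri_functor T1 T2) : tri_functor T1 T3.
Proof.
refine (@TriFunctor T1 T3 (compF G F)
  (fun X => tf_comm G (F X) ⊙ fmap G (tf_comm F X)) _ _ _).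
- move=> X; apply: is_iso_comp; first exact: tf_comm_iso.
  by apply: fmap_is_iso; apply: tf_comm_iso.
- move=> X Y f /=.
  apply: ceq_trans (ceq_sym (ccompA _ _ _)) _.
  apply: ceq_trans (ccomp_eqr _ (fmap_sq G (tf_comm_nat F f))) _.
  apply: ceq_trans (ccompA _ _ _) _.
  apply: ceq_trans (ccomp_eql _ (tf_comm_nat G _)) _.
  exact: ceq_sym (ccompA _ _ _).
- move=> X Y Z f g h d; apply: dist_iso (tf_dist G (tf_dist F d)).
  apply: tri_iso_eq; try exact: ceq_refl.
  apply: ceq_trans (ceq_sym (ccompA _ _ _)) _; apply: ccomp_eqr.
  exact: ceq_sym (fmap_comp G (tf_comm F X) (fmap F h)).
Defined.

(* a shift-stable class of objects, standing for the full subcategory on it *)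
Record subclass (T : tri_category) := Subclass {
  sc_mem :> T -> Prop;
  sc_shift : forall X, sc_mem X -> sc_mem (shift X) }.

Section FullSubcategory.
Variables (T : tri_category) (P : subclass T).

Definition full_cat : category.
Proof.
refine (@Category {X : T | P X} (fun X Y => chom (sval X) (sval Y))
  (fun X Y f g => f ≈ g) (fun X => cid (sval X))
  (fun X Y Z g f => g ⊙ f) _ _ _ _ _).
- by move=> X Y; apply: ceq_equiv.
- by move=> X Y Z g g' f f'; apply: ccomp_eq.
- by move=> *; apply: ccompA.
- by move=> *; apply: ccomp1m.
- by move=> *; apply: ccompm1.
Defined.

Definition full_shift : functor full_cat full_cat.
Proof.
refine (@Functor full_cat full_cat
  (fun X => exist _ (shift (sval X)) (sc_shift (svalP X)))
  (fun X Y f => fmap (@shift T) f) _ _ _).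
- by move=> X Y f g; apply: (fmap_eq (@shift T)).
- by move=> X; apply: (fmap_id (@shift T)).
- by move=> X Y Z g f; apply: (fmap_comp (@shift T)).
Defined.

Definition full : tri_category.
Proof.
refine (@TriCategory full_cat full_shift
  (fun X Y Z f g h => @dist T (sval X) (sval Y) (sval Z) f g h) _ _).
- move=> X Y Z f g h X' Y' Z' f' g' h' [a [b [c [[ia ib ic] e]]]].
  by apply: dist_iso; exists a, b, c; split.
- by move=> X Y Z f g h d; apply: (dist_shift d).
Defined.

Definition full_incl : functor full T :=
  @Functor full T (fun X => sval X) (fun X Y f => f) (fun X Y f g e => e)
    (fun X => ceq_refl _) (fun X Y Z g f => ceq_refl _).

Definition incl : tri_functor full T.
Proof.
refine (@TriFunctor full T full_incl (fun X => cid (shift (sval X))) _ _ _).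
- by move=> X; apply: is_iso_id.
- by move=> X Y f; apply: ceq_trans (ccomp1m _) _; exact: ceq_sym (ccompm1 _).
- move=> X Y Z f g h d; apply: (@dist_iso T) d.
  by apply: tri_iso_eq; try exact: ceq_refl; exact: ccomp1m.
Defined.

Definition restr (N : subclass T) : subclass full :=
  @Subclass full (fun X => N (sval X)) (fun X => @sc_shift T N (sval X)).

End FullSubcategory.

(* Gabriel-Zisman localization [C[W^-1]]: morphisms are formal composites of
   morphisms of [C] and of inverses of members of [W], modulo the congruence
   generated by the relations of [C] and by [s^-1 s = 1], [s s^-1 = 1]. *)
Section Localization.
Variables (C : category) (W : forall X Y : C, chom X Y -> Prop).

Inductive loc_hom : C -> C -> Type :=
| loc_map X Y (f : chom X Y) : loc_hom X Y
| loc_inv X Y (s : chom X Y) (Ws : W s) : loc_hom Y X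
| loc_comp X Y Z (q : loc_hom Y Z) (p : loc_hom X Y) : loc_hom X Z.

Inductive loc_eq : forall X Y : C, loc_hom X Y -> loc_hom X Y -> Prop :=
| loc_refl X Y (p : loc_hom X Y) : loc_eq p p
| loc_sym X Y (p q : loc_hom X Y) : loc_eq p q -> loc_eq q p
| loc_trans X Y (p q r : loc_hom X Y) : loc_eq p q -> loc_eq q r -> loc_eq p r
| loc_comp_eq X Y Z (q q' : loc_hom Y Z) (p p' : loc_hom X Y) :
    loc_eq q q' -> loc_eq p p' -> loc_eq (loc_comp q p) (loc_comp q' p')
| loc_compA X1 X2 X3 X4 (r : loc_hom X3 X4) (q : loc_hom X2 X3)
    (p : loc_hom X1 X2) :
    loc_eq (loc_comp r (loc_comp q p)) (loc_comp (loc_comp r q) p)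
| loc_comp1m X Y (p : loc_hom X Y) : loc_eq (loc_comp (loc_map (cid Y)) p) p
| loc_compm1 X Y (p : loc_hom X Y) : loc_eq (loc_comp p (loc_map (cid X))) p
| loc_map_eq X Y (f g : chom X Y) : f ≈ g -> loc_eq (loc_map f) (loc_map g)
| loc_map_comp X Y Z (g : chom Y Z) (f : chom X Y) :
    loc_eq (loc_map (g ⊙ f)) (loc_comp (loc_map g) (loc_map f))
| loc_invl X Y (s : chom X Y) (Ws : W s) :
    loc_eq (loc_comp (loc_inv Ws) (loc_map s)) (loc_map (cid X))
| loc_invr X Y (s : chom X Y) (Ws : W s) :
    loc_eq (loc_comp (loc_map s) (loc_inv Ws)) (loc_map (cid Y)).

Definition loc_cat : category.
Proof.
refine (@Category C loc_hom loc_eq (fun X => loc_map (cid X)) loc_comp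
  _ _ _ _ _).
- move=> X Y; split; [exact: loc_refl | exact: loc_sym | exact: loc_trans].
- exact: loc_comp_eq.
- exact: loc_compA.
- exact: loc_comp1m.
- exact: loc_compm1.
Defined.

Variables (S : functor C C)
  (WS : forall X Y (s : chom X Y), W s -> W (fmap S s)).

Fixpoint loc_shift_hom X Y (p : loc_hom X Y) : loc_hom (S X) (S Y) :=
  match p with
  | loc_map _ _ f => loc_map (fmap S f)
  | loc_inv _ _ s Ws => loc_inv (WS Ws)
  | loc_comp _ _ _ q p => loc_comp (loc_shift_hom q) (loc_shift_hom p)
  end.

Lemma loc_shift_id X : loc_eq (loc_map (fmap S (cid X))) (loc_map (cid (S X))).
Proof. by apply: loc_map_eq; apply: fmap_id. Qed.

Lemma loc_shift_eq X Y (p q : loc_hom X Y) :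
  loc_eq p q -> loc_eq (loc_shift_hom p) (loc_shift_hom q).
Proof.
elim=> /=.
- by move=> *; apply: loc_refl.
- by move=> *; apply: loc_sym.
- by move=> ? ? ? ? ? _ h1 _ h2; apply: loc_trans h1 h2.
- by move=> *; apply: loc_comp_eq.
- by move=> *; apply: loc_compA.
- move=> ? ? p0; apply: loc_trans (loc_comp1m _).
  by apply: loc_comp_eq (loc_shift_id _) (loc_refl _).
- move=> ? ? p0; apply: loc_trans (loc_compm1 _).
  by apply: loc_comp_eq (loc_refl _) (loc_shift_id _).
- by move=> ? ? f g e; apply: loc_map_eq; apply: fmap_eq.
- move=> ? ? ? g f; apply: loc_trans (loc_map_comp _ _).
  by apply: loc_map_eq; apply: fmap_comp.
- by move=> ? ? s Ws; apply: loc_trans (loc_invl _) (loc_sym (loc_shift_id _)).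
- by move=> ? ? s Ws; apply: loc_trans (loc_invr _) (loc_sym (loc_shift_id _)).
Qed.

Definition loc_shift : functor loc_cat loc_cat :=
  @Functor loc_cat loc_cat (fun X => S X) loc_shift_hom loc_shift_eq
    loc_shift_id (fun X Y Z g f => loc_refl _).

Definition loc_functor : functor C loc_cat :=
  @Functor C loc_cat (fun X => X) (fun X Y f => loc_map f) loc_map_eq
    (fun X => loc_refl _) loc_map_comp.

End Localization.

Section VerdierQuotient.
Variables (T : tri_category) (N : subclass T).

Definition cone_in_class (X Y : T) (s : chom X Y) : Prop :=
  exists (Z : T) (g : chom Y Z) (h : chom Z (shift X)), dist s g h /\ N Z.

Lemma cone_in_class_shift (X Y : T) (s : chom X Y) :
  cone_in_class s -> cone_in_class (fmap shift s).
Proof.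
move=> [Z [g [h [d NZ]]]]; have [g' [h' d']] := dist_shift d.
by exists (shift Z), g', h'; split=> //; apply: sc_shift.
Qed.

Definition verdier_cat : category := loc_cat cone_in_class.
Definition verdier_shift : functor verdier_cat verdier_cat :=
  loc_shift cone_in_class_shift.
Definition verdier_proj : functor T verdier_cat := loc_functor cone_in_class.

(* triangles isomorphic, in the quotient, to images of distinguished ones *)
Definition verdier_dist (X Y Z : verdier_cat) (f : chom X Y) (g : chom Y Z)
    (h : chom Z (verdier_shift X)) : Prop :=
  exists (X' Y' Z' : T) (f' : chom X' Y') (g' : chom Y' Z')
    (h' : chom Z' (shift X')),
    dist f' g' h' /\
    @tri_iso verdier_cat verdier_shift _ _ _ f g h _ _ _
      (fmap verdier_proj f') (fmap verdier_proj g') (fmap verdier_proj h').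

Definition verdier : tri_category.
Proof.
refine (@TriCategory verdier_cat verdier_shift verdier_dist _ _).
- move=> X Y Z f g h X' Y' Z' f' g' h' i.
  move=> [X0 [Y0 [Z0 [f0 [g0 [h0 [d j]]]]]]].
  by exists X0, Y0, Z0, f0, g0, h0; split=> //; apply: tri_iso_trans i j.
- move=> X Y Z f g h [X0 [Y0 [Z0 [f0 [g0 [h0 [d j]]]]]]].
  move: j => [a [b [c [[ia ib ic] [e _ _]]]]].
  have [g1 [h1 d1]] := dist_shift d.
  have [] := @tri_transport verdier_cat verdier_shift _ _ _ _ _ _
    (fmap verdier_shift f) (fmap verdier_proj (fmap shift f0))
    (fmap verdier_proj g1) (fmap verdier_proj h1) _ _ _
    (fmap_is_iso verdier_shift ia) (fmap_is_iso verdier_shift ib)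
    (fmap_is_iso verdier_shift ic) (fmap_sq verdier_shift e).
  move=> g2 [h2 i]; exists g2, h2.
  by exists (shift X0), (shift Y0), (shift Z0), (fmap shift f0), g1, h1.
Defined.

Definition verdier_functor : tri_functor T verdier.
Proof.
refine (@TriFunctor T verdier verdier_proj
  (fun X => @cid verdier (shift X)) _ _ _).
- by move=> X; apply: (@is_iso_id verdier).
- move=> X Y f; apply: ceq_trans (@ccomp1m verdier _ _ _) _.
  exact: ceq_sym (@ccompm1 verdier _ _ _).
- move=> X Y Z f g h d; exists X, Y, Z, f, g, h; split=> //.
  apply: (@tri_iso_eq verdier_cat verdier_shift); try exact: ceq_refl.
  exact: (@ccomp1m verdier).
Defined.

End VerdierQuotient.

Definition ess_image (T T' : tri_category) (F : tri_functor T T') : subclass T'.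
Proof.
refine (@Subclass T' (fun Y => exists X, isomorphic Y (F X)) _).
move=> Y [X [f fi]]; exists (shift X).
have [c [c1 c2]] := tf_comm_iso F X.
exists (c ⊙ fmap shift f); apply: is_iso_comp; last exact: fmap_is_iso.
by exists (tf_comm F X).
Defined.

Section Complexes.
Variable A : additive_category.

Lemma comp0m (X Y Z : A) (f : hom X Y) : (0 : hom Y Z) ∘ f = 0.
Proof. by apply: (addrI (0 ∘ f)); rewrite -compDl !addr0. Qed.
Lemma compm0 (X Y Z : A) (g : hom Y Z) : g ∘ (0 : hom X Y) = 0.
Proof. by apply: (addrI (g ∘ 0)); rewrite -compDr !addr0. Qed.
Lemma compNm (X Y Z : A) (g : hom Y Z) (f : hom X Y) : (- g) ∘ f = - (g ∘ f).
Proof. by apply: (addrI (g ∘ f)); rewrite -compDl !subrr comp0m. Qed.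
Lemma compmN (X Y Z : A) (g : hom Y Z) (f : hom X Y) : g ∘ (- f) = - (g ∘ f).
Proof. by apply: (addrI (g ∘ f)); rewrite -compDr !subrr compm0. Qed.
Lemma compBl (X Y Z : A) (g g' : hom Y Z) (f : hom X Y) :
  (g - g') ∘ f = g ∘ f - g' ∘ f.
Proof. by rewrite compDl compNm. Qed.
Lemma compBr (X Y Z : A) (g : hom Y Z) (f f' : hom X Y) :
  g ∘ (f - f') = g ∘ f - g ∘ f'.
Proof. by rewrite compDr compmN. Qed.

Record complex := Complex {
  cx :> int -> A;
  cd : forall n : int, hom (cx n) (cx (n + 1));
  cdd : forall n : int, cd (n + 1) ∘ cd n = 0 }.

Arguments cd : clear implicits.

Record chain_map (X Y : complex) := ChainMap {
  cm :> forall n : int, hom (X n) (Y n);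
  cm_comm : forall n : int, cm (n + 1) ∘ cd X n = cd Y n ∘ cm n }.

(* [h n] goes from degree [n + 1] to degree [n]; as every integer is of the form
   [n + 1], the equation below covers all degrees. *)
Definition homotopic (X Y : complex) (f g : chain_map X Y) : Prop :=
  exists h : forall n : int, hom (X (n + 1)) (Y n), forall n : int,
    f (n + 1) - g (n + 1) = cd Y n ∘ h n + h (n + 1) ∘ cd X (n + 1).

Definition chain_id (X : complex) : chain_map X X.
Proof.
by refine (@ChainMap X X (fun n => idm (X n)) _) => n; rewrite comp1m compm1.
Defined.

Definition chain_comp (X Y Z : complex) (g : chain_map Y Z) (f : chain_map X Y) :
  chain_map X Z.
Proof.
refine (@ChainMap X Z (fun n => g n ∘ f n) _) => n.
by rewrite -compA cm_comm compA cm_comm -compA.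
Defined.

Lemma eq_homotopic (X Y : complex) (f g : chain_map X Y) :
  (forall n, f n = g n) -> homotopic f g.
Proof.
by move=> e; exists (fun n => 0) => n; rewrite e subrr compm0 comp0m addr0.
Qed.

Definition K_cat : category.
Proof.
refine (@Category complex chain_map homotopic chain_id chain_comp _ _ _ _ _).
- move=> X Y; split.
  + by move=> f; apply: eq_homotopic.
  + move=> f g [h e]; exists (fun n => - h n) => n.
    by rewrite compmN compNm -opprD -e opprB.
  + move=> f g k [h e] [h' e']; exists (fun n => h n + h' n) => n.
    by rewrite compDr compDl addrACA -e -e' addrA subrK.
- move=> X Y Z g g' f f' [h e] [h' e'].
  exists (fun n => h n ∘ f (n + 1) + g' n ∘ h' n) => n /=.
  rewrite -[LHS](subrKA (g' (n + 1) ∘ f (n + 1))) -compBl -compBr e e'.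
  have e1 := cm_comm f (n + 1); have e2 := cm_comm g' n.
  rewrite !compDl !compDr -!compA e1 [g' _ ∘ (cd _ _ ∘ _)]compA e2 -!compA.
  by rewrite addrACA.
- by move=> *; apply: eq_homotopic => n; apply: compA.
- by move=> *; apply: eq_homotopic => n; apply: comp1m.
- by move=> *; apply: eq_homotopic => n; apply: compm1.
Defined.

Definition shift_complex (X : complex) : complex.
Proof.
refine (@Complex (fun n => X (n + 1)) (fun n => - cd X (n + 1)) _) => n.
by rewrite compNm compmN opprK cdd.
Defined.

Definition shift_map (X Y : complex) (f : chain_map X Y) :
  chain_map (shift_complex X) (shift_complex Y).
Proof.
refine (@ChainMap (shift_complex X) (shift_complex Y) (fun n => f (n + 1)) _).
by move=> n; rewrite /= compmN compNm cm_comm.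
Defined.

Definition K_shift : functor K_cat K_cat.
Proof.
refine (@Functor K_cat K_cat shift_complex shift_map _ _ _).
- move=> X Y f g [h e]; exists (fun n => - h (n + 1)) => n /=.
  by rewrite e !compNm !compmN !opprK.
- by move=> X; apply: eq_homotopic.
- by move=> *; apply: eq_homotopic.
Defined.

(* The cone of [f : X -> Y] is [X^{n+1} ⊕ Y^n] in degree [n], with differential
   [(x, y) |-> (- d x, f x + d y)]. *)
Section Cone.
Variables (X Y : complex) (f : chain_map X Y).

Let B (n : int) := biproduct (X (n + 1)) (Y n).

Definition cone_d (n : int) : hom (bp_obj (B n)) (bp_obj (B (n + 1))) :=
  bp_inl (B (n + 1)) ∘ (- cd X (n + 1)) ∘ bp_prl (B n)
  + bp_inr (B (n + 1)) ∘ (f (n + 1) ∘ bp_prl (B n) + cd Y n ∘ bp_prr (B n)).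

Lemma bp_prl_pair (U V T : A) (D : biproduct_data (@idm A) (@comp A) U V)
  (u : hom T U) (v : hom T V) : bp_prl D ∘ (bp_inl D ∘ u + bp_inr D ∘ v) = u.
Proof. by rewrite compDr !compA bp_ll bp_lr comp1m comp0m addr0. Qed.

Lemma bp_prr_pair (U V T : A) (D : biproduct_data (@idm A) (@comp A) U V)
  (u : hom T U) (v : hom T V) : bp_prr D ∘ (bp_inl D ∘ u + bp_inr D ∘ v) = v.
Proof. by rewrite compDr !compA bp_rl bp_rr comp1m comp0m add0r. Qed.

Lemma bp_prP (U V T : A) (D : biproduct_data (@idm A) (@comp A) U V)
    (u v : hom T (bp_obj D)) :
  bp_prl D ∘ u = bp_prl D ∘ v -> bp_prr D ∘ u = bp_prr D ∘ v -> u = v.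
Proof.
move=> e1 e2; rewrite -[u]comp1m -[v]comp1m -bp_id !compDl -!compA.
by rewrite e1 e2.
Qed.

Lemma prl_cone_d n :
  bp_prl (B (n + 1)) ∘ cone_d n = - (cd X (n + 1) ∘ bp_prl (B n)).
Proof. by rewrite /cone_d -compA bp_prl_pair compNm. Qed.

Lemma prr_cone_d n :
  bp_prr (B (n + 1)) ∘ cone_d n =
  f (n + 1) ∘ bp_prl (B n) + cd Y n ∘ bp_prr (B n).
Proof. by rewrite /cone_d -compA bp_prr_pair. Qed.

Definition cone : complex.
Proof.
refine (@Complex (fun n => bp_obj (B n)) cone_d _) => n.
apply: bp_prP; rewrite compA.
  rewrite prl_cone_d compNm -compA prl_cone_d compmN opprK compA cdd comp0m.
  by rewrite compm0.
rewrite prr_cone_d compDl -!compA prl_cone_d prr_cone_d compmN compDr !compA.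
by rewrite cdd comp0m addr0 cm_comm addNr compm0.
Defined.

Definition cone_inj : chain_map Y cone.
Proof.
refine (@ChainMap Y cone (fun n => bp_inr (B n)) _) => n /=.
apply: bp_prP; rewrite !compA.
  by rewrite prl_cone_d bp_lr comp0m compNm -compA bp_lr compm0 oppr0.
by rewrite prr_cone_d bp_rr comp1m compDl -!compA bp_lr bp_rr compm0 compm1 add0r.
Defined.

Definition cone_proj : chain_map cone (shift_complex X).
Proof.
refine (@ChainMap cone (shift_complex X) (fun n => bp_prl (B n)) _) => n /=.
by rewrite prl_cone_d compNm.
Defined.

End Cone.

Definition K_dist (X Y Z : K_cat) (f : chom X Y) (g : chom Y Z)
    (h : chom Z (K_shift X)) : Prop :=
  exists (X' Y' : complex) (f' : chain_map X' Y'),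
    @tri_iso K_cat K_shift _ _ _ f g h X' Y' (cone f') f' (cone_inj f')
      (cone_proj f').

Lemma shift_cone_iso (X Y : complex) (f : chain_map X Y) :
  exists u : @chom K_cat (shift_complex (cone f)) (cone (shift_map f)),
    is_iso u.
Proof.
pose D (n : int) := biproduct (X (n + 1)) (Y n).
pose s (n : int) : hom (bp_obj (D n)) (bp_obj (D n)) :=
  bp_inl (D n) ∘ bp_prl (D n) + bp_inr (D n) ∘ (- bp_prr (D n)).
have sl n : bp_prl (D n) ∘ s n = bp_prl (D n) by rewrite bp_prl_pair.
have sr n : bp_prr (D n) ∘ s n = - bp_prr (D n) by rewrite bp_prr_pair.
have ss n : s n ∘ s n = idm _.
  apply: bp_prP; rewrite compA compm1; first by rewrite !sl.
  by rewrite sr compNm sr opprK.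
have comm1 n : s (n + 1 + 1) ∘ - cone_d f (n + 1) =
               cone_d (shift_map f) n ∘ s (n + 1).
  apply: bp_prP; rewrite !compA ?sl ?sr.
    by rewrite compmN !prl_cone_d /= !compNm -compA sl.
  rewrite compNm compmN opprK !prr_cone_d compDl -!compA sl sr /=.
  by rewrite compNm compmN opprK.
have comm2 n : s (n + 1 + 1) ∘ cone_d (shift_map f) n =
               (- cone_d f (n + 1)) ∘ s (n + 1).
  rewrite -[RHS]comp1m -(ss (n + 1 + 1)) -compA; congr (_ ∘ _).
  by rewrite compA comm1 -compA ss compm1.
exists (@ChainMap (shift_complex (cone f)) (cone (shift_map f))
  (fun n => s (n + 1)) comm1).
exists (@ChainMap (cone (shift_map f)) (shift_complex (cone f))
  (fun n => s (n + 1)) comm2).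
by split; apply: eq_homotopic => n; apply: ss.
Qed.

Definition K : tri_category.
Proof.
refine (@TriCategory K_cat K_shift K_dist _ _).
- move=> X Y Z f g h X' Y' Z' f' g' h' i [X0 [Y0 [f0 j]]].
  by exists X0, Y0, f0; apply: tri_iso_trans i j.
- move=> X Y Z f g h [X0 [Y0 [f0 [a [b [c [[ia ib ic] [e _ _]]]]]]]].
  have [u iu] := shift_cone_iso f0.
  have [] := @tri_transport K_cat K_shift _ _ _ _ _ _
    (fmap K_shift f) (shift_map f0) (cone_inj (shift_map f0))
    (cone_proj (shift_map f0)) _ _ _
    (fmap_is_iso K_shift ia) (fmap_is_iso K_shift ib)
    (is_iso_comp iu (fmap_is_iso K_shift ic)) (fmap_sq K_shift e).
  move=> g2 [h2 i]; exists g2, h2.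
  by exists (shift_complex X0), (shift_complex Y0), (shift_map f0).
Defined.

End Complexes.

Arguments cd {A} c n.

Lemma is_kernel_opp (A : additive_category) (X Y : A) (f : hom X Y) (U : A)
  (k : hom U X) : is_kernel f k -> is_kernel (- f) k.
Proof.
move=> [e H]; split; first by rewrite compNm e oppr0.
by move=> T t /eqP; rewrite compNm oppr_eq0 => /eqP; apply: H.
Qed.

Lemma epi_opp (A : additive_category) (X Y : A) (f : hom X Y) :
  epi f -> epi (- f).
Proof. by move=> H T u v; rewrite !compmN => /oppr_inj; apply: H. Qed.

Definition bounded_above (A : additive_category) : subclass (K A).
Proof.
refine (@Subclass (K A)
  (fun X : complex A => exists N : int, forall n, N <= n -> is_zero (X n)) _).
move=> X [N H]; exists N => n hn; apply: H.
by apply: le_trans hn _; rewrite lerDl.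
Defined.

Definition acyclic (A : additive_category) : subclass (K A).
Proof.
refine (@Subclass (K A)
  (fun X : complex A => forall n, exact_at (cd X n) (cd X (n + 1))) _).
move=> X H n /=; have [U [k [u [hk hu e]]]] := H (n + 1).
exists U, k, (- u); split; [exact: is_kernel_opp | exact: epi_opp|].
by rewrite compmN -e.
Defined.

(* Hom(P,X) is acyclic for all lam-pure projective P, in particular
   ([lpresentable_pure_projective]) for all lam-presentable P *)
Definition lpure_acyclic (lam : small) (A : additive_category) :
  subclass (K A).
Proof.
refine (@Subclass (K A)
  (fun X : complex A => forall P : A, lpure_projective lam P ->
     forall n (x : hom P (X (n + 1))), cd X (n + 1) ∘ x = 0 ->
     exists y : hom P (X n), cd X n ∘ y = x) _).
move=> X H P hP n x /= /eqP; rewrite compNm oppr_eq0 => /eqP /(H _ hP)[y e].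
by exists (- y); rewrite compmN compNm opprK.
Defined.

(* The quotient K_ac^-(A)/K_lam^-(A) makes sense: with enough projectives,
   lam-pure acyclic complexes are acyclic. *)
Lemma lpure_acyclic_acyclic (lam : small) (A : additive_category) (X : K A) :
  is_abelian A -> enough_projectives A -> lpure_acyclic lam A X -> acyclic A X.
Proof.
move=> [kers _ _ _] enough H n.
have [U [k [k0 kU]]] := kers _ _ (cd X (n + 1)).
have [u [ku _]] := kU _ (cd X n) (cdd X n).
exists U, k, u; split=> //; have [P [p [projP epi_p]]] := enough U.
have PP : lpure_projective lam P.
  move=> V V' W f g [[[gf _] [_ cokg]] _]; apply: projP => T t t' e.
  have tg0 : t ∘ g ∘ f = 0 by rewrite -compA gf compm0.
  have [v [_ vU]] := cokg T (t ∘ g) tg0.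
  by rewrite -(vU t erefl) -(vU t' (esym e)).
have [|y dy] := H P PP n (k ∘ p); first by rewrite compA k0 comp0m.
have uy : u ∘ y = p.
  have kp0 : cd X (n + 1) ∘ (k ∘ p) = 0 by rewrite compA k0 comp0m.
  have [v [_ vU]] := kU P (k ∘ p) kp0.
  by rewrite -(vU p erefl) -(vU (u ∘ y)) // compA ku.
by move=> T t t' e; apply: epi_p; rewrite -uy !compA e.
Qed.

Definition lpure_projective_terms (lam : small) (A : additive_category) :
  subclass (K A) :=
  @Subclass (K A) (fun X : complex A => forall n, lpure_projective lam (X n))
    (fun X H n => H (n + 1)).

Section Categories.
Variables (lam : small) (A : additive_category).

Definition Kminus : tri_category := full (bounded_above A).

Definition ac_Kminus : subclass Kminus := restr _ (acyclic A).
Definition lam_Kminus : subclass Kminus := restr _ (lpure_acyclic lam A).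
Definition PP_Kminus : subclass Kminus := restr _ (lpure_projective_terms lam A).

Definition Kminus_ac : tri_category := full ac_Kminus.
Definition Kminus_PP : tri_category := full PP_Kminus.

Definition lam_Kminus_ac : subclass Kminus_ac := restr _ lam_Kminus.
Definition ac_Kminus_PP : subclass Kminus_PP := restr _ ac_Kminus.

Definition Kminus_ac_PP : tri_category := full ac_Kminus_PP.

Definition Dminus : tri_category := verdier ac_Kminus.
Definition Dminus_lam : tri_category := verdier lam_Kminus.

Definition PP_to_Dminus_lam : tri_functor Kminus_PP Dminus_lam :=
  comp_tri (verdier_functor lam_Kminus) (incl PP_Kminus).

(* K_ac^-(PP) is viewed inside D_lam^-(A) as its image, closed under
   isomorphism, under the canonical functor from K^-(PP). *)
Definition ac_PP_Dminus_lam : subclass Dminus_lam :=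
  ess_image (comp_tri PP_to_Dminus_lam (incl ac_Kminus_PP)).

End Categories.

(* Main.v *)
(** For every bounded above complex [X] there is a map [r : P -> X] with [P] in
    K^-(PP) whose cone is pure acyclic, and a map with pure acyclic cone is
    inverted by Hom(P, -) for all [P] in K^-(PP).  So [X |-> P] is a triangle
    functor, right adjoint to the inclusion, which inverts the maps with pure
    acyclic cone, and preserves acyclic complexes because pure acyclic complexes
    are acyclic.  The three equivalences then follow from the universal property
    of localization, without a calculus of fractions: both functors are induced
    ones, and the two natural isomorphisms are given by [r].

    The resolutions need pure projective precovers.  For a [lam]-presentable
    [F] and a generator [G], the quotients of [F] by the images of fewer than
    [lam] maps [G -> F] form a [lam]-directed system with colimit zero, so one of
    them vanishes.  Hence the [lam]-presentable objects are quotients of a fixed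
    coproduct of copies of [G], and they form a set up to isomorphism.  The
    category need not be locally [lam]-presentable, but adding a projective
    summand to a coproduct of [lam]-presentable objects makes the map onto [X]
    an epimorphism. *)
From Stdlib Require Import RelationClasses Morphisms Setoid.
From mathcomp Require Import all_boot all_order all_algebra.
From mathcomp Require Import boolp classical_sets functions cardinality.
Require Import Defs.

Set Implicit Arguments.
Unset Strict Implicit.
Unset Printing Implicit Defensive.

Import Order.TTheory GRing.Theory Num.Theory.
Local Open Scope ring_scope.

(** * Equations in abelian groups by reflection *)

Inductive zexp :=
  ZVar of nat | ZZero | ZAdd of zexp & zexp | ZOpp of zexp.

Section ZmodReflection.
Variables (V : zmodType) (env : seq V).

Fixpoint zeval (e : zexp) : V :=
  match e with
  | ZVar i => env`_i
  | ZZero => 0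
  | ZAdd e1 e2 => zeval e1 + zeval e2
  | ZOpp e1 => - zeval e1
  end.

(** Positive and negative occurrences of an atom are counted separately, so integer coefficients are
    compared through equations in [nat] that compute. *)
Fixpoint zcoef (e : zexp) (pos : bool) (i : nat) : nat :=
  match e with
  | ZVar j => pos && (i == j)
  | ZZero => 0
  | ZAdd e1 e2 => zcoef e1 pos i + zcoef e2 pos i
  | ZOpp e1 => zcoef e1 (~~ pos) i
  end.

Lemma zevalE (e : zexp) :
  zeval e = \sum_(i < size env)
    (env`_i *+ zcoef e true i - env`_i *+ zcoef e false i).
Proof.
elim: e => [j||e1 IH1 e2 IH2|e IH] /=.
- have [lt_j|ge_j] := ltnP j (size env).
    rewrite (bigD1 (Ordinal lt_j)) //= eqxx mulr1n mulr0n subr0 big1 ?addr0 //.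
    by move=> i /negPf; rewrite -val_eqE /= => ->; rewrite !mulr0n subr0.
  rewrite nth_default // big1 // => i _.
  by rewrite (ltn_eqF (leq_trans (ltn_ord i) ge_j)) !mulr0n subr0.
- by rewrite big1 // => i _; rewrite mulr0n subr0.
- rewrite IH1 IH2 -big_split /=; apply: eq_bigr => i _.
  by rewrite !mulrnDr opprD addrACA.
- by rewrite IH -sumrN; apply: eq_bigr => i _; rewrite opprB.
Qed.

Lemma zmod_reflect (e1 e2 : zexp) :
  all (fun i => zcoef e1 true i + zcoef e2 false i ==
                zcoef e2 true i + zcoef e1 false i)%N (iota 0 (size env)) ->
  zeval e1 = zeval e2.
Proof.
move=> /allP H; rewrite !zevalE; apply: eq_bigr => i _.
have /H /eqP e : nat_of_ord i \in iota 0 (size env) by rewrite mem_iota /=.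
by apply/eqP; rewrite subr_eq addrAC -mulrnDr eq_sym subr_eq -mulrnDr e.
Qed.

End ZmodReflection.

Ltac zmod_mem x l :=
  lazymatch l with
  | nil => false
  | cons ?y ?l' =>
      match constr:(Set) with
      | _ => let _ := match constr:(Set) with _ => unify x y end in true
      | _ => zmod_mem x l'
      end
  end.

Ltac zmod_index x l :=
  lazymatch l with
  | cons ?y ?l' =>
      match constr:(Set) with
      | _ => let _ := match constr:(Set) with _ => unify x y end in constr:(O)
      | _ => let n := zmod_index x l' in constr:(S n)
      end
  end.

Ltac zmod_atoms t l :=
  lazymatch t with
  | (?a + ?b)%R => let l' := zmod_atoms a l in zmod_atoms b l'
  | (- ?a)%R => zmod_atoms a l
  | (0)%R => l
  | _ => lazymatch zmod_mem t l with
         | true => l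
         | false => constr:(cons t l)
         end
  end.

Ltac zmod_reify t l :=
  lazymatch t with
  | (?a + ?b)%R =>
      let u := zmod_reify a l in let v := zmod_reify b l in constr:(ZAdd u v)
  | (- ?a)%R => let u := zmod_reify a l in constr:(ZOpp u)
  | (0)%R => constr:(ZZero)
  | _ => let i := zmod_index t l in constr:(ZVar i)
  end.

(* Decides equations between sums of atoms in an abelian group. *)
Ltac zmod :=
  lazymatch goal with
  | |- @eq ?V ?a ?b =>
      let l0 := zmod_atoms a (@nil V) in
      let l := zmod_atoms b l0 in
      let u := zmod_reify a l in
      let v := zmod_reify b l in
      exact (@zmod_reflect _ l u v (erefl true))
  end.

(** Reduces a goal to a known equation [l = r]; the second premise is then an identity that [zmod]
    decides. *)
Lemma zlin1 (V : zmodType) (a b l r : V) : l = r -> a - b = l - r -> a = b.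
Proof. by move=> -> /eqP; rewrite subrr subr_eq0 => /eqP. Qed.

(** * Localizations *)

#[local] Instance ceq_Equivalence (C : category) (X Y : C) :
  Equivalence (@ceq C X Y) := @ceq_equiv C X Y.

#[local] Instance ccomp_Proper (C : category) (X Y Z : C) :
  Proper (@ceq C Y Z ==> @ceq C X Y ==> @ceq C X Z) (@ccomp C X Y Z).
Proof. by move=> g g' eg f f' ef; apply: ccomp_eq. Qed.

#[local] Instance fmap_Proper (C D : category) (F : functor C D) (X Y : C) :
  Proper (@ceq C X Y ==> @ceq D (F X) (F Y)) (@fmap C D F X Y).
Proof. by move=> f g; apply: fmap_eq. Qed.

#[local] Hint Resolve ceq_refl : core.

Section IsoCancellation.
Variable C : category.

Lemma iso_cancel_l (X Y Z : C) (s : chom Y Z) (f g : chom X Y) :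
  is_iso s -> s ⊙ f ≈ s ⊙ g -> f ≈ g.
Proof.
move=> [t [ts _]] e; rewrite -(ccomp1m f) -(ccomp1m g) -ts -!ccompA.
by apply: ccomp_eqr.
Qed.

Lemma iso_cancel_r (X Y Z : C) (s : chom X Y) (f g : chom Y Z) :
  is_iso s -> f ⊙ s ≈ g ⊙ s -> f ≈ g.
Proof.
move=> [t [_ st]] e; rewrite -(ccompm1 f) -(ccompm1 g) -st !ccompA.
by apply: ccomp_eql.
Qed.

Lemma inv_square (X Y X' Y' : C) (f : chom X Y) (f' : chom X' Y')
    (a : chom X X') (b : chom Y Y') (g : chom Y X) (g' : chom Y' X') :
  inverses f g -> inverses f' g' -> b ⊙ f ≈ f' ⊙ a -> a ⊙ g ≈ g' ⊙ b.
Proof.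
move=> [_ fg] [g'f' _] e.
rewrite -(ccompm1 (g' ⊙ b)) -fg -(ccompA g' b) (ccompA b f g) e.
by rewrite -(ccompA f' a g) (ccompA g' f') g'f' ccomp1m.
Qed.

End IsoCancellation.

Section LocalizationLift.
Variables (C D : category) (W : forall X Y : C, chom X Y -> Prop).
Variable F : functor C D.
Hypothesis F_inv : forall (X Y : C) (s : chom X Y), W s -> is_iso (fmap F s).

(** Morphisms of the localization are formal words, so the induced functor is defined by recursion
    on them; choice picks the inverses in [D]. *)
Fixpoint loc_lift_hom X Y (p : loc_hom W X Y) : chom (F X) (F Y) :=
  match p with
  | loc_map _ _ f => fmap F f
  | loc_inv _ _ s Ws => sval (boolp.cid (F_inv Ws))
  | loc_comp _ _ _ q p => loc_lift_hom q ⊙ loc_lift_hom p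
  end.

Lemma loc_lift_hom_inv X Y (s : chom X Y) (Ws : W s) :
  inverses (fmap F s) (loc_lift_hom (loc_inv Ws)).
Proof. by rewrite /=; case: boolp.cid. Qed.

Lemma loc_lift_hom_eq X Y (p q : loc_hom W X Y) :
  loc_eq p q -> loc_lift_hom p ≈ loc_lift_hom q.
Proof.
elim=> {X Y p q}.
- by move=> *; reflexivity.
- by move=> *; symmetry.
- by move=> X Y p q r _ e _ e'; rewrite e.
- by move=> X Y Z q q' p p' _ e _ e' /=; apply: ccomp_eq.
- by move=> *; apply: ccompA.
- by move=> X Y p /=; rewrite fmap_id ccomp1m.
- by move=> X Y p /=; rewrite fmap_id ccompm1.
- by move=> X Y f g e; apply: fmap_eq.
- by move=> X Y Z g f; apply: fmap_comp.
- move=> X Y s Ws; have [e _] := loc_lift_hom_inv Ws.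
  by apply: ceq_trans e _; rewrite /= fmap_id.
- move=> X Y s Ws; have [_ e] := loc_lift_hom_inv Ws.
  by apply: ceq_trans e _; rewrite /= fmap_id.
Qed.

Definition loc_lift : functor (loc_cat W) D :=
  @Functor (loc_cat W) D (fun X => F X) loc_lift_hom loc_lift_hom_eq
    (fun X => fmap_id F X) (fun X Y Z g f => ceq_refl _).

End LocalizationLift.

Lemma loc_inverses (C : category) (W : forall X Y : C, chom X Y -> Prop)
    (X Y : C) (s : chom X Y) (Ws : W X Y s) :
  @inverses (loc_cat W) X Y (loc_map W s) (loc_inv Ws).
Proof. by split; [apply: loc_invl | apply: loc_invr]. Qed.

Lemma loc_map_is_iso (C : category) (W : forall X Y : C, chom X Y -> Prop)
    (X Y : C) (s : chom X Y) :
  W X Y s -> @is_iso (loc_cat W) X Y (loc_map W s).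
Proof. by move=> Ws; exists (loc_inv Ws); apply: loc_inverses. Qed.

Lemma inverses_fmap (C D : category) (F : functor C D) (X Y : C)
    (f : chom X Y) (g : chom Y X) :
  inverses f g -> inverses (fmap F f) (fmap F g).
Proof. by move=> [h1 h2]; split; rewrite -fmap_comp (h1, h2) fmap_id. Qed.

(** A naturality square for [s] yields one for its formal inverse, and squares paste, so only maps
    coming from [C] have to be checked. *)
Lemma loc_natural (C D : category) (W : forall X Y : C, chom X Y -> Prop)
    (G H : functor (loc_cat W) D) (a : forall X : C, chom (G X) (H X)) :
  (forall (X Y : C) (f : chom X Y),
    a Y ⊙ @fmap _ _ G X Y (loc_map W f) ≈
    @fmap _ _ H X Y (loc_map W f) ⊙ a X) ->
  forall (X Y : loc_cat W) (p : chom X Y), a Y ⊙ fmap G p ≈ fmap H p ⊙ a X.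
Proof.
move=> nat_a X Y; elim=> {X Y} [X Y f|X Y s Ws|X Y Z q IHq p IHp].
- exact: nat_a.
- have i := loc_inverses Ws.
  exact: inv_square (inverses_fmap G i) (inverses_fmap H i) (nat_a _ _ _).
- have eG := @fmap_comp _ _ G X Y Z q p; have eH := @fmap_comp _ _ H X Y Z q p.
  apply: ceq_trans (ccomp_eqr _ eG) _.
  apply: ceq_trans _ (ccomp_eql _ (ceq_sym eH)).
  by rewrite ccompA IHq -ccompA IHp ccompA.
Qed.

Section VerdierLift.
Variables (T U : tri_category) (N : subclass T) (F : tri_functor T U).
Hypothesis F_inv : forall (X Y : T) (s : chom X Y),
  cone_in_class N s -> is_iso (fmap F s).

Let F' := loc_lift F_inv.

Lemma verdier_lift_comm (X Y : verdier N) (p : chom X Y) :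
  tf_comm F Y ⊙ fmap F' (fmap shift p) ≈ fmap shift (fmap F' p) ⊙ tf_comm F X.
Proof.
pose G := compF F' (@shift (verdier N)); pose H := compF (@shift U) F'.
exact: (@loc_natural _ _ _ G H (fun X => tf_comm F X) (fun X Y f =>
  tf_comm_nat F f)).
Qed.

Definition verdier_lift : tri_functor (verdier N) U.
Proof.
refine (@TriFunctor (verdier N) U F' (fun X => tf_comm F X) _ _ _).
- by move=> X; apply: tf_comm_iso.
- exact: verdier_lift_comm.
(* A distinguished triangle of the quotient is isomorphic to the image of one of [T], and [F']
   carries that isomorphism to [U]. *)
- move=> X Y Z f g h [X' [Y' [Z' [f' [g' [h' [d i]]]]]]].
  case: i => [a [b [c [[ia ib ic] [e1 e2 e3]]]]].
  apply: dist_iso (tf_dist F d).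
  exists (fmap F' a), (fmap F' b), (fmap F' c); split.
    by split; apply: fmap_is_iso.
  split; [exact: (fmap_sq F' e1) | exact: (fmap_sq F' e2) |].
  rewrite ccompA -verdier_lift_comm -!ccompA; apply: ccomp_eqr.
  exact: (fmap_sq F' e3).
Defined.

End VerdierLift.

Lemma verdier_functor_inverts (T U : tri_category) (N : subclass T)
    (N' : subclass U) (F : tri_functor T U) :
  (forall X, N X -> N' (F X)) ->
  forall (X Y : T) (s : chom X Y), cone_in_class N s ->
  is_iso (fmap (comp_tri (verdier_functor N') F) s).
Proof.
move=> FN X Y s [Z [g [h [d NZ]]]].
apply: (@loc_map_is_iso U); exists (F Z), (fmap F g), (tf_comm F X ⊙ fmap F h).
by split; [apply: tf_dist | apply: FN].
Qed.

(** * Localizing along a coreflection *)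

Section Coreflection.
Variables (T : tri_category) (P N L : subclass T).

(** Bijectivity of Hom(Q, s) for all [Q] in [P], split into surjectivity and injectivity. *)
Definition local (X Y : T) (s : chom X Y) : Prop := forall Q, P Q ->
  (forall f : chom Q Y, exists g : chom Q X, s ⊙ g ≈ f) /\
  (forall g g' : chom Q X, s ⊙ g ≈ s ⊙ g' -> g ≈ g').

Lemma local_comp (X Y Z : T) (t : chom Y Z) (s : chom X Y) :
  local t -> local s -> local (t ⊙ s).
Proof.
move=> ht hs Q PQ; have [ht1 ht2] := ht Q PQ; have [hs1 hs2] := hs Q PQ.
split=> [f|g g' e].
  have [g tg] := ht1 f; have [k sk] := hs1 g.
  by exists k; rewrite -ccompA sk.
by apply: hs2; apply: ht2; rewrite !ccompA.
Qed.

Lemma local_iso (X Y Z : T) (s : chom X Z) (t : chom Y Z) (u : chom X Y) :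
  P X -> P Y -> local s -> local t -> t ⊙ u ≈ s -> is_iso u.
Proof.
move=> PX PY hs ht tu; have [v sv] := (hs Y PY).1 t.
exists v; split.
  by apply: (hs X PX).2; rewrite ccompA sv tu ccompm1.
by apply: (ht Y PY).2; rewrite ccompA tu sv ccompm1.
Qed.

Lemma full_is_iso (X Y : full P) (u : chom X Y) :
  @is_iso T (sval X) (sval Y) u -> is_iso u.
Proof. by []. Qed.

Hypothesis resolution : forall X : T,
  exists (Q : T) (r : chom Q X), P Q /\ cone_in_class L r.
Hypothesis cone_local : forall (X Y : T) (s : chom X Y),
  cone_in_class L s -> local s.
(** A [tri_category] carries no axiom completing a square to a map of triangles. The instance used
    by the resolution functor is assumed here; for complexes it comes from mapping cones. *)
Hypothesis triangle_resolution :
  forall (X Y Z : T) (f : chom X Y) (g : chom Y Z) (h : chom Z (shift X))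
    (X0 Y0 : T) (a : chom X0 X) (b : chom Y0 Y) (p : chom X0 Y0),
  dist f g h -> P X0 -> P Y0 -> cone_in_class L a -> cone_in_class L b ->
  b ⊙ p ≈ f ⊙ a ->
  exists (Z0 : T) (g0 : chom Y0 Z0) (h0 : chom Z0 (shift X0)) (c : chom Z0 Z),
    [/\ P Z0, dist p g0 h0, cone_in_class L c, c ⊙ g0 ≈ g ⊙ b
      & fmap shift a ⊙ h0 ≈ h ⊙ c].

Let res_sig (X : T) :
  {Q : T & {r : chom Q X | P Q /\ cone_in_class L r}}.
Proof.
have [Q Qr] := boolp.cid (resolution X); have [r ?] := boolp.cid Qr.
by exists Q, r.
Qed.

Definition res_obj (X : T) : full P :=
  exist _ (projT1 (res_sig X)) (svalP (projT2 (res_sig X))).1.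

Definition res_map (X : T) : chom (sval (res_obj X)) X :=
  sval (projT2 (res_sig X)).

Lemma res_map_cone (X : T) : cone_in_class L (res_map X).
Proof. exact: (svalP (projT2 (res_sig X))).2. Qed.

Lemma res_map_local (X : T) : local (res_map X).
Proof. exact: cone_local (res_map_cone X). Qed.

Let res_fmap_sig (X Y : T) (f : chom X Y) :
  {g : chom (sval (res_obj X)) (sval (res_obj Y))
     | res_map Y ⊙ g ≈ f ⊙ res_map X}.
Proof.
exact: boolp.cid ((res_map_local Y (svalP (res_obj X))).1 (f ⊙ res_map X)).
Qed.

Definition res_fmap (X Y : T) (f : chom X Y) : chom (res_obj X) (res_obj Y) :=
  sval (res_fmap_sig f).

Lemma res_fmapE (X Y : T) (f : chom X Y) :
  @ccomp T _ _ _ (res_map Y) (res_fmap f) ≈ f ⊙ res_map X.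
Proof. exact: svalP (res_fmap_sig f). Qed.

Lemma res_ext (X : full P) (Y : T) (g g' : chom X (res_obj Y)) :
  @ccomp T _ _ _ (res_map Y) g ≈ @ccomp T _ _ _ (res_map Y) g' -> g ≈ g'.
Proof. exact: (res_map_local Y (svalP X)).2. Qed.

(** All functor laws follow from uniqueness of lifts along [res_map]. *)
Definition res_functor : functor T (full P).
Proof.
refine (@Functor T (full P) res_obj res_fmap _ _ _).
- by move=> X Y f g e; apply: res_ext; rewrite !res_fmapE e.
- move=> X; apply: res_ext; rewrite res_fmapE ccomp1m.
  exact: ceq_sym (ccompm1 _).
- move=> X Y Z g f; apply: res_ext; rewrite res_fmapE.
  apply: ceq_trans _ (ceq_sym (ccompA _ _ _)).
  by rewrite res_fmapE -!ccompA res_fmapE.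
Defined.

(** The shift of [res_map X] again has its cone in [L], hence is local, so [res_map (shift X)] lifts
    along it. *)
Let res_comm_sig (X : T) :
  {c : chom (res_obj (shift X)) (shift (res_obj X))
     | @ccomp T _ _ _ (fmap shift (res_map X)) c ≈ res_map (shift X)}.
Proof.
have hl := cone_local (cone_in_class_shift (res_map_cone X)).
exact: boolp.cid ((hl _ (svalP (res_obj (shift X)))).1 (res_map (shift X))).
Qed.

Definition res_comm (X : T) : chom (res_obj (shift X)) (shift (res_obj X)) :=
  sval (res_comm_sig X).

Lemma res_commE (X : T) :
  @ccomp T _ _ _ (fmap shift (res_map X)) (res_comm X) ≈ res_map (shift X).
Proof. exact: svalP (res_comm_sig X). Qed.

Lemma shift_res_local (X : T) : local (fmap shift (res_map X)).
Proof. exact: cone_local (cone_in_class_shift (res_map_cone X)). Qed.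

Definition res_tri : tri_functor T (full P).
Proof.
refine (@TriFunctor T (full P) res_functor res_comm _ _ _).
- move=> X; apply: full_is_iso.
  apply: local_iso (res_map_local (shift X)) (shift_res_local X) (res_commE X).
    exact: svalP (res_obj (shift X)).
  exact: svalP (shift (res_obj X)).
- move=> X Y f; apply: (shift_res_local Y (svalP (res_obj (shift X)))).2.
  rewrite /= !ccompA res_commE res_fmapE -fmap_comp res_fmapE fmap_comp.
  by rewrite -ccompA res_commE.
- move=> X Y Z f g h d.
  (* The resolved triangle ends in some [Z0] rather than in the chosen resolution of [Z]. Both have
     local maps to [Z], so the lift [u] between them is an isomorphism. *)
  have [Z0 [g0 [h0 [c [PZ0 d0 Lc e1 e2]]]]] := triangle_resolution d
    (svalP (res_obj X)) (svalP (res_obj Y)) (res_map_cone X) (res_map_cone Y)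
    (res_fmapE f).
  have [u eu] := (res_map_local Z PZ0).1 c.
  have iu : is_iso u := local_iso PZ0 (svalP (res_obj Z)) (cone_local Lc)
    (res_map_local Z) eu.
  have [v [vu uv]] := iu; have iv : is_iso v by exists u.
  apply: (@dist_iso T) d0.
  exists (cid (sval (res_obj X))), (cid (sval (res_obj Y))), v.
  split; first by split=> //; apply: is_iso_id.
  split; first by rewrite ccomp1m ccompm1.
    rewrite ccompm1; apply: (iso_cancel_l iu); rewrite ccompA uv ccomp1m.
    apply: (res_map_local Z (svalP (res_obj Y))).2.
    by rewrite res_fmapE ccompA eu e1.
  rewrite fmap_id ccomp1m; apply: (iso_cancel_r iu).
  rewrite -!ccompA vu ccompm1.
  apply: (shift_res_local X PZ0).2.
  by rewrite !ccompA res_commE res_fmapE e2 -ccompA eu.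
Defined.

(** Both [s ⊙ res_map X] and [res_map Y] are local maps from objects of [P] to [Y], and such maps
    have isomorphic sources. *)
Lemma res_inverts (X Y : T) (s : chom X Y) :
  cone_in_class L s -> is_iso (fmap res_tri s).
Proof.
move=> Ls; apply: full_is_iso.
apply: (local_iso (svalP (res_obj X)) (svalP (res_obj Y)) _
  (res_map_local Y) (res_fmapE s)).
exact: local_comp (cone_local Ls) (res_map_local X).
Qed.

Lemma res_map_iso (X : full P) : @is_iso (full P) (res_obj (sval X)) X
  (res_map (sval X)).
Proof.
apply: full_is_iso.
have loc1 : local (cid (sval X)).
  move=> Q _; split=> [f|g g']; last by rewrite !ccomp1m.
  by exists f; rewrite ccomp1m.
apply: (local_iso (svalP (res_obj (sval X))) (svalP X) (res_map_local _) loc1).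
exact: ccomp1m.
Qed.

Hypothesis L_sub_N : forall X, L X -> N X.
Hypothesis N_pullback : forall (X Y : T) (s : chom X Y),
  cone_in_class L s -> N Y -> N X.
Hypothesis N_iso : forall X Y : T, isomorphic X Y -> N Y -> N X.

Lemma res_N (X : T) : N X -> N (sval (res_obj X)).
Proof. exact: N_pullback (res_map_cone X). Qed.

Lemma cone_in_class_mono (M M' : subclass T) (X Y : T) (s : chom X Y) :
  (forall Z, M Z -> M' Z) -> cone_in_class M s -> cone_in_class M' s.
Proof. by move=> MM' [Z [g [h [d MZ]]]]; exists Z, g, h; split; auto. Qed.

Lemma full_cone (M : subclass T) (X Y : full N) (s : chom X Y) :
  cone_in_class (restr N M) s -> @cone_in_class T M (sval X) (sval Y) s.
Proof. by move=> [Z [g [h [d MZ]]]]; exists (sval Z), g, h. Qed.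

(** Objects of [full (restr P N)] are nested pairs with [P] inside; the functor forgets [P] and
    keeps the proof of [N]. *)
Definition full_restr_incl : tri_functor (full (restr P N)) (full N).
Proof.
refine (@TriFunctor (full (restr P N)) (full N)
  (@Functor (full (restr P N)) (full N)
     (fun X => exist _ (sval (sval X)) (svalP X)) (fun X Y f => f)
     (fun X Y f g e => e) (fun X => ceq_refl _) (fun X Y Z g f => ceq_refl _))
  (fun X => @cid T (shift (sval (sval X)))) _ _ _).
- by move=> X; apply: (@is_iso_id T).
- move=> X Y f.
  exact: ceq_trans (@ccomp1m T _ _ _) (ceq_sym (@ccompm1 T _ _ _)).
- move=> X Y Z f g h d; apply: (@dist_iso T) d.
  by apply: tri_iso_eq; try exact: ceq_refl; exact: ccomp1m.
Defined.

Definition res_restr : functor (full N) (full (restr P N)) :=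
  @Functor (full N) (full (restr P N))
    (fun X => exist _ (res_obj (sval X)) (res_N (svalP X)))
    (fun X Y f => @res_fmap (sval X) (sval Y) f)
    (fun X Y f g e => @fmap_eq _ _ res_functor (sval X) (sval Y) f g e)
    (fun X => fmap_id res_functor (sval X))
    (fun X Y Z g f =>
       @fmap_comp _ _ res_functor (sval X) (sval Y) (sval Z) g f).

Lemma res_restr_inverts (X Y : full N) (s : chom X Y) :
  cone_in_class (restr N L) s -> is_iso (fmap res_restr s).
Proof. by move=> /full_cone /res_inverts. Qed.

(** The third vertex of the triangle must itself be an object of [full N]; this is where the
    inclusion of [L] in [N] enters. *)
Lemma res_map_restr_cone (X : full N) :
  @cone_in_class (full N) (restr N L)
    (full_restr_incl (res_restr X)) X (res_map (sval X)).
Proof.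
have [Z [g [h [d LZ]]]] := res_map_cone (sval X).
by exists (exist _ Z (L_sub_N LZ)), g, h.
Qed.

(** The triangle functor is inclusion followed by the quotient. [is_equivalence] asks only for a
    plain functor backwards, so [res_restr] carries no triangle structure. *)
Lemma restr_equivalent :
  tri_equivalent (full (restr P N)) (verdier (restr N L)).
Proof.
exists (comp_tri (verdier_functor (restr N L)) full_restr_incl).
exists (loc_lift res_restr_inverts); split.
  exists (fun X => res_map (sval (sval X))); split.
    by move=> X; apply: (res_map_iso (sval X)).
  by move=> X Y f; apply: res_fmapE.
exists (fun X => loc_map (@cone_in_class (full N) (restr N L))
   (res_map (sval X) : @chom (full N)
      (full_restr_incl (res_restr X)) X)); split.
  by move=> X; apply: loc_map_is_iso; apply: res_map_restr_cone.
apply: loc_natural => X Y f /=.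
by apply: (fmap_sq (verdier_functor (restr N L))); apply: res_fmapE.
Qed.

Definition res_verdier : tri_functor (verdier N) (verdier (restr P N)) :=
  verdier_lift
    (@verdier_functor_inverts T (full P) N (restr P N) res_tri res_N).

Lemma incl_inverts (X Y : full P) (s : chom X Y) :
  cone_in_class (restr P N) s ->
  is_iso (fmap (comp_tri (verdier_functor N) (incl P)) s).
Proof. exact: verdier_functor_inverts. Qed.

(** Resolution and inclusion both preserve [N], hence descend to the quotients. The maps [res_map]
    have cone in [L], so in [N], and on [P] they are already isomorphisms. *)
Lemma verdier_res_equivalent :
  tri_equivalent (verdier N) (verdier (restr P N)).
Proof.
exists res_verdier, (verdier_lift incl_inverts); split.
  exists (fun X => loc_map (cone_in_class N) (res_map X)); split.
    move=> X; apply: loc_map_is_iso.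
    exact: cone_in_class_mono L_sub_N (res_map_cone X).
  apply: loc_natural => X Y f /=.
  by apply: (fmap_sq (verdier_functor N)); apply: res_fmapE.
exists (fun X => loc_map (@cone_in_class (full P) (restr P N))
   (res_map (sval X) : @chom (full P) (res_obj (sval X)) X)); split.
  move=> X; apply: (fmap_is_iso (verdier_functor (restr P N))).
  exact: res_map_iso.
apply: loc_natural => X Y f /=.
by apply: (fmap_sq (verdier_functor (restr P N))); apply: res_fmapE.
Qed.

Let PL : tri_functor (full P) (verdier L) :=
  comp_tri (verdier_functor L) (incl P).
Let E : subclass (verdier L) := ess_image (comp_tri PL (incl (restr P N))).

Definition res_verdier_local : tri_functor (verdier L) (full P) :=
  verdier_lift res_inverts.

(** Membership in [E] gives an isomorphism in [verdier L]; [res_verdier_local] turns it into one in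
    [full P], and [N] is closed under isomorphism. *)
Lemma res_ess_image (X : verdier L) : E X -> restr P N (res_verdier_local X).
Proof.
move=> [Y [f fi]]; have NY : N (sval (sval Y)) by exact: svalP Y.
have [v hv] := fmap_is_iso res_verdier_local fi.
apply: (N_iso _ (res_N NY)).
by exists (fmap res_verdier_local f), v.
Qed.

Lemma PL_ess_image (X : full P) : restr P N X -> E (PL X).
Proof.
move=> NX; exists (exist _ X NX); exists (cid (PL X)); exact: is_iso_id.
Qed.

Lemma verdier_ess_image_equivalent :
  tri_equivalent (verdier (restr P N)) (verdier E).
Proof.
pose F := verdier_lift (verdier_functor_inverts PL_ess_image).
pose G := verdier_lift (@verdier_functor_inverts _ _ E (restr P N)
  res_verdier_local res_ess_image).
exists F, G; split.
  exists (fun X => loc_map (@cone_in_class (full P) (restr P N))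
   (res_map (sval X) : @chom (full P) (res_obj (sval X)) X)); split.
    move=> X; apply: (fmap_is_iso (verdier_functor (restr P N))).
    exact: res_map_iso.
  apply: loc_natural => X Y f /=.
  by apply: (fmap_sq (verdier_functor (restr P N))); apply: res_fmapE.
exists (fun X => loc_map (@cone_in_class (verdier L) E)
  (loc_map (@cone_in_class T L) (res_map X))); split.
  move=> X; apply: (fmap_is_iso (verdier_functor E)).
  by apply: loc_map_is_iso; apply: res_map_cone.
apply: loc_natural => X Y f.
(* There are two nested localizations. The outer one has been reduced to morphisms of [verdier L]; a
   second reduction leads to morphisms of [T]. *)
have nat1 : forall (X Y : verdier L) (p : chom X Y),
   (loc_map (@cone_in_class T L) (res_map Y) : @chom (verdier L) _ _) ⊙
   fmap (comp_tri PL res_verdier_local) p ≈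
   p ⊙ (loc_map (@cone_in_class T L) (res_map X) : @chom (verdier L) _ _).
  apply: (@loc_natural _ _ _ (comp_tri PL res_verdier_local) (idF (verdier L))).
  move=> {}X {}Y {}f.
  by apply: (fmap_sq (verdier_functor L)); apply: res_fmapE.
exact: (fmap_sq (verdier_functor E) (nat1 X Y f)).
Qed.

End Coreflection.

(** * Complexes tested on a class of objects *)

Lemma int_succP (P : int -> Prop) : (forall n, P (n + 1)) -> forall n, P n.
Proof. by move=> H n; rewrite -(subrK 1 n). Qed.

(** Homotopies yield components in degrees of the form [n + 1]. Transport along [n - 1 + 1 = n]
    reindexes them, and uniqueness of equality proofs on [int] removes the transport. *)
Lemma int_succ_family (F : int -> Type) (f : forall n, F (n + 1)) :
  exists g : forall n, F n, forall n, g (n + 1) = f n.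
Proof.
exists (fun n => eq_rect (n - 1 + 1) F (f (n - 1)) n (subrK 1 n)) => n.
move: (subrK 1 (n + 1)); move E: (n + 1 - 1) => m e.
have emn : m = n by rewrite -E addrK.
by subst m; rewrite emn in e *; rewrite (eq_irrelevance e (erefl _)).
Qed.

Section TestObjects.
Variables (A : additive_category) (E : A -> Prop).
Implicit Types X Y Z : complex A.

(** The class [E] stays abstract because two are used: pure projectives, which give pure acyclicity,
    and projectives, which detect ordinary acyclicity. *)
Definition test_acyclic X : Prop := forall Q, E Q ->
  forall (n : int) (x : hom Q (X (n + 1))), cd X (n + 1) ∘ x = 0 ->
  exists y : hom Q (X n), cd X n ∘ y = x.

(** Injectivity on the cohomology of Hom(Q, -), expressed by cycles and boundaries; [h_surj] is
    surjectivity. *)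
Definition h_inj X Y (s : chain_map X Y) : Prop := forall Q, E Q ->
  forall (n : int) (x : hom Q (X (n + 1))), cd X (n + 1) ∘ x = 0 ->
  (exists y : hom Q (Y n), cd Y n ∘ y = s (n + 1) ∘ x) ->
  exists z : hom Q (X n), cd X n ∘ z = x.

Definition h_surj X Y (s : chain_map X Y) : Prop := forall Q, E Q ->
  forall (n : int) (y : hom Q (Y (n + 1))), cd Y (n + 1) ∘ y = 0 ->
  exists x : hom Q (X (n + 1)), cd X (n + 1) ∘ x = 0 /\
  exists z : hom Q (Y n), cd Y n ∘ z = y - s (n + 1) ∘ x.

Definition test_qis X Y (s : chain_map X Y) : Prop := h_inj s /\ h_surj s.

Lemma comm_el X Y (s : chain_map X Y) (n : int) Q (x : hom Q (X n)) :
  s (n + 1) ∘ (cd X n ∘ x) = cd Y n ∘ (s n ∘ x).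
Proof. by rewrite compA cm_comm -compA. Qed.

Lemma test_qis_comp X Y Z (t : chain_map Y Z) (s : chain_map X Y) :
  test_qis t -> test_qis s -> test_qis (chain_comp t s).
Proof.
move=> [ti ts] [si ss]; split=> Q EQ n x dx.
  move=> [y /=]; rewrite -compA => dy; apply: (si Q EQ n x dx).
  apply: (ti Q EQ n); last by exists y.
  by rewrite -comm_el dx compm0.
have [y [dy [z dz]]] := ts Q EQ n x dx.
have [w [dw [v dv]]] := ss Q EQ n y dy.
exists w; split=> //; exists (z + t n ∘ v); rewrite compDr dz -comm_el dv /=.
by rewrite compBr compA; zmod.
Qed.

Lemma homotopic_boundary X Y (s t : chain_map X Y) (n : int) Q
    (x : hom Q (X (n + 1))) :
  homotopic s t -> cd X (n + 1) ∘ x = 0 ->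
  exists z, cd Y n ∘ z = s (n + 1) ∘ x - t (n + 1) ∘ x.
Proof.
move=> [h e] dx; exists (h n ∘ x).
by rewrite -compBl e compDl -!compA dx compm0 addr0.
Qed.

Lemma test_qis_homotopic X Y (s t : chain_map X Y) :
  homotopic s t -> test_qis s -> test_qis t.
Proof.
move=> st [si ss]; split=> Q EQ n x dx.
  move=> [y dy]; apply: (si Q EQ n x dx).
  have [z dz] := homotopic_boundary st dx.
  by exists (y + z); rewrite compDr dz dy; zmod.
have [w [dw [v dv]]] := ss Q EQ n x dx; exists w; split=> //.
have [z dz] := homotopic_boundary st dw.
by exists (v + z); rewrite compDr dz dv; zmod.
Qed.

Lemma test_qis_iso X Y (s : chain_map X Y) :
  @is_iso (K_cat A) X Y s -> test_qis s.
Proof.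
move=> [t [ts st]]; split=> Q EQ n x dx.
  move=> [y dy]; have [z /=] := homotopic_boundary ts dx.
  rewrite comp1m -compA -dy comm_el => dz.
  exists (t n ∘ y - z); rewrite compBr dz; zmod.
exists (t (n + 1) ∘ x); split; first by rewrite -comm_el dx compm0.
have [z /=] := homotopic_boundary st dx; rewrite comp1m -compA => dz.
by exists (- z); rewrite compmN dz; zmod.
Qed.

Lemma test_qis_acyclic X Y (s : chain_map X Y) :
  test_qis s -> test_acyclic Y -> test_acyclic X.
Proof.
move=> [si _] Ya Q EQ n x dx; apply: (si Q EQ n x dx).
by apply: (Ya Q EQ); rewrite -comm_el dx compm0.
Qed.

Section ConeElements.
Variables (X Y : complex A) (s : chain_map X Y).

Definition cone_pair (n : int) Q (x : hom Q (X (n + 1))) (y : hom Q (Y n)) :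
  hom Q (cone s n) := bp_inl _ ∘ x + bp_inr _ ∘ y.

Definition cone_fst (n : int) Q (w : hom Q (cone s n)) : hom Q (X (n + 1)) :=
  bp_prl _ ∘ w.
Definition cone_snd (n : int) Q (w : hom Q (cone s n)) : hom Q (Y n) :=
  bp_prr _ ∘ w.

Lemma cone_fst_pair (n : int) Q (x : hom Q (X (n + 1))) (y : hom Q (Y n)) :
  cone_fst (cone_pair x y) = x.
Proof. exact: bp_prl_pair. Qed.

Lemma cone_snd_pair (n : int) Q (x : hom Q (X (n + 1))) (y : hom Q (Y n)) :
  cone_snd (cone_pair x y) = y.
Proof. exact: bp_prr_pair. Qed.

Lemma cone_ext (n : int) Q (v w : hom Q (cone s n)) :
  cone_fst v = cone_fst w -> cone_snd v = cone_snd w -> v = w.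
Proof. exact: bp_prP. Qed.

Lemma cone_fst_d (n : int) Q (w : hom Q (cone s n)) :
  cone_fst (cd (cone s) n ∘ w) = - (cd X (n + 1) ∘ cone_fst w).
Proof.
by have := congr1 (fun u => u ∘ w) (prl_cone_d s n); rewrite compNm -!compA.
Qed.

Lemma cone_snd_d (n : int) Q (w : hom Q (cone s n)) :
  cone_snd (cd (cone s) n ∘ w) =
  s (n + 1) ∘ cone_fst w + cd Y n ∘ cone_snd w.
Proof.
by have := congr1 (fun u => u ∘ w) (prr_cone_d s n); rewrite compDl -!compA.
Qed.

Lemma cone_fstD (n : int) Q (v w : hom Q (cone s n)) :
  cone_fst (v + w) = cone_fst v + cone_fst w.
Proof. exact: compDr. Qed.
Lemma cone_sndD (n : int) Q (v w : hom Q (cone s n)) :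
  cone_snd (v + w) = cone_snd v + cone_snd w.
Proof. exact: compDr. Qed.
Lemma cone_fstN (n : int) Q (v : hom Q (cone s n)) :
  cone_fst (- v) = - cone_fst v.
Proof. exact: compmN. Qed.
Lemma cone_sndN (n : int) Q (v : hom Q (cone s n)) :
  cone_snd (- v) = - cone_snd v.
Proof. exact: compmN. Qed.
Lemma cone_fst0 (n : int) Q : cone_fst (0 : hom Q (cone s n)) = 0.
Proof. exact: compm0. Qed.
Lemma cone_snd0 (n : int) Q : cone_snd (0 : hom Q (cone s n)) = 0.
Proof. exact: compm0. Qed.
Lemma cone_fst_comp (n : int) Q R (w : hom Q (cone s n)) (u : hom R Q) :
  cone_fst (w ∘ u) = cone_fst w ∘ u.
Proof. exact: compA. Qed.
Lemma cone_snd_comp (n : int) Q R (w : hom Q (cone s n)) (u : hom R Q) :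
  cone_snd (w ∘ u) = cone_snd w ∘ u.
Proof. exact: compA. Qed.

Lemma cone_fst_inj n : cone_fst (cone_inj s n) = 0.
Proof. exact: bp_lr. Qed.
Lemma cone_snd_inj n : cone_snd (cone_inj s n) = idm _.
Proof. exact: bp_rr. Qed.

Definition coneE := (cone_fst_pair, cone_snd_pair, cone_fst_d, cone_snd_d,
  cone_fstD, cone_sndD, cone_fstN, cone_sndN, cone_fst0, cone_snd0,
  cone_fst_comp, cone_snd_comp,
  cone_fst_inj, cone_snd_inj).

Lemma test_qis_cone : test_qis s -> test_acyclic (cone s).
Proof.
move=> [si ss] Q EQ n w dw.
have dx : cd X (n + 1 + 1) ∘ cone_fst w = 0.
  by apply: oppr_inj; rewrite -cone_fst_d dw !coneE oppr0.
have sx : s (n + 1 + 1) ∘ cone_fst w + cd Y (n + 1) ∘ cone_snd w = 0.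
  by rewrite -cone_snd_d dw !coneE.
(* By [h_inj] the first component is a boundary [d x1]. The second component corrected by [s x1] is
   then a cycle, which [h_surj] hits by [x2] up to the boundary of [y]. *)
have [|x1 dx1] := si Q EQ _ _ dx.
  by exists (- cone_snd w); apply: (zlin1 (esym sx)); rewrite compmN; zmod.
have [|x2 [dx2 [y dy]]] := ss Q EQ n (cone_snd w + s (n + 1) ∘ x1).
  by rewrite compDr -comm_el dx1 -[RHS]sx; zmod.
exists (cone_pair (x2 - x1) y); apply: cone_ext; rewrite !coneE.
  by rewrite compBr dx1 dx2; zmod.
by rewrite dy compBr; zmod.
Qed.

Lemma cone_test_qis : test_acyclic (cone s) -> test_qis s.
Proof.
move=> ac; split=> Q EQ; last first.
  move=> n y dy; have [|w dw] := ac Q EQ n (cone_pair 0 y).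
    by apply: cone_ext; rewrite !coneE ?compm0 ?oppr0 // dy addr0.
  exists (cone_fst w); split.
    by apply: oppr_inj; rewrite -cone_fst_d dw !coneE oppr0.
  exists (cone_snd w).
  by have := congr1 (@cone_snd _ _) dw; rewrite !coneE => <-; zmod.
(* The cycle [(x, -y)] lies in cone degree one below that of [x]; this degree has to be a successor
   for [test_acyclic] to apply. *)
apply: int_succP => n x dx [y dy].
have [|w dw] := ac Q EQ n (cone_pair x (- y)).
  by apply: cone_ext; rewrite !coneE ?compmN ?dx ?dy ?oppr0 // subrr.
exists (- cone_fst w); have := congr1 (@cone_fst _ _) dw; rewrite !coneE => <-.
by rewrite compmN.
Qed.

End ConeElements.
End TestObjects.

(** * Descending recursion on degrees *)

Section Descent.
Variables (N : int).

Lemma int_descend_ind (P : int -> Prop) :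
  (forall n : int, N <= n -> P n) -> (forall n, P (n + 1) -> P n) ->
  forall n, P n.
Proof.
move=> base step n; have [le_Nn|/ltW le_nN] := lerP N n; first exact: base.
have [k ek] : exists k : nat, N = n + k%:Z.
  by exists (absz (N - n)%R); rewrite gez0_abs ?subr_ge0 //; zmod.
elim: k n ek {le_nN} => [|k IH] n ek; first by apply: base; rewrite ek addr0.
by apply: step; apply: IH; rewrite ek -addrA -intS.
Qed.

Variables (S : int -> Type) (R : forall n : int, S (n + 1) -> S n -> Prop).
Variable z : forall n, S n.
Hypothesis R_base : forall n : int, N <= n -> R (z (n + 1)) (z n).
Hypothesis R_step : forall (n : int) (s' : S (n + 1)), exists s : S n, R s' s.

(** [t k n] starts from [z] at [k] degrees above [n] and steps down [k] times. Taking [k = N - n]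
    below [N] makes all these finite chains start at [N], hence agree. *)
Lemma int_descend : exists s : forall n, S n,
  (forall n : int, N <= n -> s n = z n) /\ forall n, R (s (n + 1)) (s n).
Proof.
pose next n s' : S n := sval (boolp.cid (@R_step n s')).
have nextP n s' : R s' (next n s') by rewrite /next; case: boolp.cid.
pose t := fix t (k : nat) (n : int) : S n :=
  if k is k'.+1 then next n (t k' (n + 1)) else z n.
exists (fun n => t (if n < N then absz (N - n)%R else 0%N) n).
split=> n; first by move=> le_Nn; rewrite ltNge le_Nn.
have [le_Nn|lt_nN] := lerP N n.
  by rewrite ltNge (le_trans le_Nn) ?lerDl //=; apply: R_base.
have [k ek] : exists k : nat, N = n + k.+1%:Z.
  exists (absz (N - n - 1)%R); rewrite intS gez0_abs; first by zmod.
  by rewrite subr_ge0 -gtz0_ge1 subr_gt0.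
have -> : absz (N - n)%R = k.+1 by rewrite ek addrAC subrr add0r.
have -> : (if n + 1 < N then absz (N - (n + 1))%R else 0%N) = k.
  have -> : N - (n + 1) = k%:Z by rewrite ek intS; zmod.
  by rewrite ek intS addrA ltrDl; case: k {ek}.
exact: nextP.
Qed.

End Descent.

(** * Null homotopies and lifting along maps with test acyclic cone *)

Section NullHomotopy.
Variables (A : additive_category) (E : A -> Prop).

Lemma null_homotopy (Q C : complex A) (f : chain_map Q C) :
  (exists N : int, forall n : int, N <= n -> is_zero (Q n)) ->
  (forall n, E (Q n)) -> test_acyclic E C ->
  exists h : forall n : int, hom (Q (n + 1)) (C n), forall n : int,
    f (n + 1) = cd C n ∘ h n + h (n + 1) ∘ cd Q (n + 1).
Proof.
move=> [N Q0] EQ Cac.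
(* As [f] is a chain map, [I n h] says that [f n - h ∘ cd Q n] takes values in cycles, so acyclicity
   provides the homotopy one degree lower. *)
pose I (n : int) (h : hom (Q (n + 1)) (C n)) :=
  cd C n ∘ (h ∘ cd Q n) = f (n + 1) ∘ cd Q n.
pose R (n : int) (h' : hom (Q (n + 1 + 1)) (C (n + 1)))
    (h : hom (Q (n + 1)) (C n)) :=
  I (n + 1) h' -> f (n + 1) = cd C n ∘ h + h' ∘ cd Q (n + 1) /\ I n h.
have E0 (n : int) T (u v : hom (Q n) T) : N <= n -> u = v.
  by move=> le_Nn; have [_ H] := Q0 n le_Nn T; rewrite (H u) (H v).
have le1 (n : int) : N <= n -> N <= n + 1.
  by move=> le_Nn; apply: le_trans le_Nn _; rewrite lerDl.
have [n le_Nn|n h'|h [_ hR]] := @int_descend N _ R (fun n => 0).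
- by move=> _; split; apply: E0; rewrite ?le1.
(* [R] is conditional on the invariant so that every [h'] has a successor; where the invariant
   fails, zero serves. *)
- have [Ih'|nI] := pselect (I (n + 1) h'); last by exists 0.
  have [|h dh] := Cac (Q (n + 1)) (EQ _) n (f (n + 1) - h' ∘ cd Q (n + 1)).
    by rewrite compBr Ih' cm_comm subrr.
  exists h => _; split; first by rewrite dh subrK.
  by rewrite /I compA dh compBl -compA cdd compm0 subr0.
exists h => n; apply: (proj1 (hR n _)).
move: {n}(n + 1); apply: (@int_descend_ind N) => n.
  by move=> le_Nn; apply: E0.
by case/hR.
Qed.

(** A null homotopy of [f] followed by [cone_inj s] has a lift of [f] as first component and the
    comparison homotopy as second. For injectivity, [g - g'] and a homotopy [k] form a chain map
    from the shift of [Q] to the cone, and its null homotopy gives one from [g] to [g']. *)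
Lemma cone_null_local (Q X Y : complex A) (s : chain_map X Y) :
  (exists N : int, forall n : int, N <= n -> is_zero (Q n)) ->
  (forall n, E (Q n)) -> test_acyclic E (cone s) ->
  (forall f : chain_map Q Y, exists g : chain_map Q X,
     homotopic (chain_comp s g) f) /\
  (forall g g' : chain_map Q X,
     homotopic (chain_comp s g) (chain_comp s g') -> homotopic g g').
Proof.
move=> Qb EQ ac; split=> [f|g g' [k ek]].
  have [h eh] := null_homotopy (chain_comp (cone_inj s) f) Qb EQ ac.
  have [g eg] := int_succ_family (F := fun n => hom (Q n) (X n))
    (fun n => cone_fst (h n)).
  have gc : forall n, g (n + 1) ∘ cd Q n = cd X n ∘ g n.
    apply: int_succP => n; rewrite !eg.
    have := congr1 (@cone_fst _ _ _ _ _ _) (eh n); rewrite !coneE.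
    by rewrite comp0m; move=> e; apply: (zlin1 (esym e)); zmod.
  exists (ChainMap gc), (fun n => - cone_snd (h n)) => n /=.
  have := congr1 (@cone_snd _ _ _ _ _ _) (eh n); rewrite !coneE.
  by rewrite comp1m => ->; rewrite eg compmN compNm; zmod.
have Fc (n : int) : cone_pair s (g (n + 1 + 1) - g' (n + 1 + 1)) (- k (n + 1))
    ∘ cd (shift_complex Q) n =
    cd (cone s) n ∘ cone_pair s (g (n + 1) - g' (n + 1)) (- k n).
  apply: cone_ext; rewrite !coneE /= compmN.
    by rewrite compBl compBr !cm_comm.
  rewrite compNm !compmN opprK compBr.
  by apply: (zlin1 (esym (ek n))); rewrite /=; zmod.
have [||h eh] := @null_homotopy (shift_complex Q) (cone s) (ChainMap Fc) _ _ ac.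
- case: Qb => N Q0; exists N => n le_Nn; apply: Q0.
  by apply: le_trans le_Nn _; rewrite lerDl.
- by move=> n; apply: EQ.
have [H eH] := int_succ_family (F := fun n => hom (Q (n + 1)) (X n))
    (fun n => - cone_fst (h n)).
exists H; apply: int_succP => n; rewrite !eH.
have := congr1 (@cone_fst _ _ _ _ _ _) (eh n); rewrite /= !coneE => ->.
by rewrite !compmN compNm; zmod.
Qed.

End NullHomotopy.

(** * Maps of cones and the five lemma *)

Section ConeMap.
Variables (A : additive_category) (E : A -> Prop).
Variables (X0 Y0 X Y : complex A) (p : chain_map X0 Y0) (f : chain_map X Y).
Variables (a : chain_map X0 X) (b : chain_map Y0 Y).
Variable k : forall n : int, hom (X0 (n + 1)) (Y n).
Hypothesis ek : forall n : int, b (n + 1) ∘ p (n + 1) - f (n + 1) ∘ a (n + 1) =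
  cd Y n ∘ k n + k (n + 1) ∘ cd X0 (n + 1).

(** On elements this is [(x, y) |-> (a x, b y + k x)]; the term [k x] compensates for a square that
    commutes only up to homotopy. *)
Definition cone_map_fun (n : int) : hom (cone p n) (cone f n) :=
  cone_pair f (a (n + 1) ∘ cone_fst (idm _))
    (b n ∘ cone_snd (idm _) + k n ∘ cone_fst (idm _)).

Lemma cone_map_fst (n : int) Q (w : hom Q (cone p n)) :
  cone_fst (cone_map_fun n ∘ w) = a (n + 1) ∘ cone_fst w.
Proof. by rewrite !coneE -compA -cone_fst_comp comp1m. Qed.

Lemma cone_map_snd (n : int) Q (w : hom Q (cone p n)) :
  cone_snd (cone_map_fun n ∘ w) = b n ∘ cone_snd w + k n ∘ cone_fst w.
Proof.
by rewrite !coneE compDl -(compA (b n)) -(compA (k n)) -cone_fst_comp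
  -cone_snd_comp comp1m.
Qed.

Lemma cone_map_comm (n : int) :
  cone_map_fun (n + 1) ∘ cd (cone p) n = cd (cone f) n ∘ cone_map_fun n.
Proof.
rewrite -[cd _ _]compm1 -[cone_map_fun n]compm1; apply: cone_ext.
  by rewrite cone_map_fst !cone_fst_d cone_map_fst compmN comm_el.
rewrite cone_map_snd !cone_snd_d cone_fst_d cone_map_snd cone_map_fst.
rewrite !compDr comm_el compmN.
move: (cone_fst _) (cone_snd _) => x y.
have := congr1 (fun u => u ∘ x) (ek n).
rewrite compBl compDl -!compA => e; apply: (zlin1 e); zmod.
Qed.

Definition cone_map : chain_map (cone p) (cone f) := ChainMap cone_map_comm.

Hypotheses (qa : test_qis E a) (qb : test_qis E b).

Let ek_el (n : int) Q (x : hom Q (X0 (n + 1))) :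
  cd X0 (n + 1) ∘ x = 0 ->
  b (n + 1) ∘ (p (n + 1) ∘ x) =
  f (n + 1) ∘ (a (n + 1) ∘ x) + cd Y n ∘ (k n ∘ x).
Proof.
move=> dx; have := congr1 (fun u => u ∘ x) (ek n).
rewrite compBl compDl -!compA dx compm0 => e; apply: (zlin1 e); zmod.
Qed.

Lemma cone_cycle (X1 Y1 : complex A) (s : chain_map X1 Y1) (n : int) Q
    (w : hom Q (cone s n)) : cd (cone s) n ∘ w = 0 ->
  cd X1 (n + 1) ∘ cone_fst w = 0 /\
  s (n + 1) ∘ cone_fst w + cd Y1 n ∘ cone_snd w = 0.
Proof.
move=> dw; split; last by rewrite -cone_snd_d dw !coneE.
by apply: oppr_inj; rewrite -cone_fst_d dw !coneE oppr0.
Qed.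

Lemma cone_map_h_surj : h_surj E cone_map.
Proof.
move=> Q EQ n w dw; have [dx' dy'] := cone_cycle dw.
have [x [dx [x1 dx1]]] := qa.2 Q EQ _ _ dx'.
have := ek_el dx.
have dpx : cd Y0 (n + 1 + 1) ∘ (p (n + 1 + 1) ∘ x) = 0.
  by rewrite -comm_el dx compm0.
set x' := cone_fst w in dx' dy' dx1 *; set y' := cone_snd w in dy' *.
move=> ebp.
(* As [b (p x)] is a boundary, so is [p x]; then [(x, -y1)] is a cycle of the cone of [p], to be
   corrected by the cycle [y2]. *)
have [|y1 dy1] := qb.1 Q EQ _ _ dpx.
  exists (- y' - f (n + 1) ∘ x1 + k (n + 1) ∘ x).
  rewrite ebp !compDr !compmN -comm_el dx1 compBr.
  by apply: (zlin1 (esym dy')); zmod.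
have [|y2 [dy2 [y3 dy3]]] :=
    qb.2 Q EQ n (y' + b (n + 1) ∘ y1 - k (n + 1) ∘ x + f (n + 1) ∘ x1).
  rewrite !(compDr, compmN) -!comm_el dx1 dy1 compBr ebp.
  by apply: (zlin1 dy'); zmod.
exists (cone_pair p x (y2 - y1)); split.
  apply: cone_ext; rewrite !coneE ?dx ?oppr0 //.
  by rewrite compBr dy2 dy1; zmod.
exists (cone_pair f (- x1) y3); apply: cone_ext.
  rewrite cone_fst_d cone_fstD cone_fstN cone_map_fst !coneE compmN opprK.
  exact: dx1.
rewrite cone_snd_d cone_sndD cone_sndN cone_map_snd !coneE dy3 compmN compBr.
zmod.
Qed.

Lemma cone_map_h_inj : h_inj E cone_map.
Proof.
move=> Q EQ n w dw [w' ew']; have [dx dy] := cone_cycle dw.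
have := congr1 (@cone_fst _ _ _ _ _ _) ew'.
have := congr1 (@cone_snd _ _ _ _ _ _) ew'.
rewrite cone_fst_d cone_snd_d cone_map_fst cone_map_snd.
set x' := cone_fst w'; set y' := cone_snd w'.
set x := cone_fst w in dx dy *; set y := cone_snd w in dy *.
move=> ey ex.
have [|x1 dx1] := qa.1 Q EQ _ _ dx; first by exists (- x'); rewrite compmN.
(* The primitive [x1] of [x] is free up to a cycle. The correction [x2] makes [b] send the remaining
   second component to a boundary. *)
have [|x2 [dx2 [x3 dx3]]] := qa.2 Q EQ n (x' + a (n + 1) ∘ x1).
  by rewrite compDr -comm_el dx1 -ex; zmod.
have ek1 := congr1 (fun u => u ∘ (x2 - x1)) (ek n).
have [||y1 dy1] := qb.1 Q EQ n (y - p (n + 1) ∘ (x2 - x1)).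
- rewrite compBr -comm_el compBr dx2 dx1 sub0r compmN opprK -[RHS]dy; zmod.
- exists (f n ∘ x3 + y' - k n ∘ (x2 - x1)).
  rewrite !(compDr, compmN) -comm_el dx3 !(compDr, compmN).
  move: ek1; rewrite !(compDl, compNm, compDr, compmN) -!compA dx1 dx2 compm0.
  by move=> e; apply: (zlin1 (congr2 +%R e ey)); zmod.
exists (cone_pair p (x2 - x1) y1); apply: cone_ext.
  by rewrite cone_fst_d cone_fst_pair compBr dx2 dx1 sub0r opprK.
by rewrite cone_snd_d cone_fst_pair cone_snd_pair dy1; zmod.
Qed.

Lemma cone_map_test_qis : test_qis E cone_map.
Proof. by split; [apply: cone_map_h_inj | apply: cone_map_h_surj]. Qed.

End ConeMap.

(** * Resolutions of bounded above complexes *)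

Definition precovering (A : additive_category) (E : A -> Prop) : Prop :=
  forall X : A, exists P (p : hom P X), E P /\
    forall Q, E Q -> forall h : hom Q X, exists h' : hom Q P, p ∘ h' = h.

Section Resolution.
Variables (A : additive_category) (E : A -> Prop).
Hypothesis kernels : forall (X Y : A) (f : hom X Y),
  exists K (k : hom K X), is_kernel f k.
Hypothesis E_zero : forall Z, is_zero Z -> E Z.
Hypothesis E_cover : precovering E.
Variable X : complex A.

(* The degree [n] part of a resolution [P -> X] under construction, together
   with the kernel of the differential leaving it.  Recording the kernel rather
   than the differential keeps the type independent of the previous stage. *)
Record stage (n : int) := Stage {
  st_obj : A;
  st_map : hom st_obj (X n);
  st_ker : A;
  st_inc : hom st_ker st_obj }.

(** The last clause says that the new object maps onto the pullback of [X n] and the kernel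
    [st_ker s'] over [X (n + 1)], as seen by Hom(Q, -). *)
Definition stage_diff (n : int) (s' : stage (n + 1)) (s : stage n)
    (d : hom (st_obj s) (st_obj s')) : Prop :=
  [/\ is_kernel d (st_inc s), st_map s' ∘ d = cd X n ∘ st_map s,
      exists e, d = st_inc s' ∘ e
    & forall Q, E Q -> forall (c : hom Q (st_ker s')) (x : hom Q (X n)),
        st_map s' ∘ (st_inc s' ∘ c) = cd X n ∘ x ->
        exists y, d ∘ y = st_inc s' ∘ c /\ st_map s ∘ y = x].
Arguments stage_diff {n} s' s d.

Definition stage_link (n : int) (s' : stage (n + 1)) (s : stage n) : Prop :=
  E (st_obj s) /\ exists d, stage_diff s' s d.

(** The new object is an [E]-precover [P] of that pullback [U], itself the kernel of a difference on
    a biproduct. *)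
Lemma stage_step (n : int) (s' : stage (n + 1)) :
  exists s : stage n, stage_link s' s.
Proof.
pose B := biproduct (st_ker s') (X n).
have [U [u [du uU]]] :=
  kernels (st_map s' ∘ st_inc s' ∘ bp_prl B - cd X n ∘ bp_prr B).
have [P [p [EP pP]]] := E_cover U.
have [V [v kv]] := kernels (st_inc s' ∘ (bp_prl B ∘ (u ∘ p))).
exists (Stage (bp_prr B ∘ (u ∘ p)) v); split=> //=.
exists (st_inc s' ∘ (bp_prl B ∘ (u ∘ p))); split=> //=.
- have := congr1 (fun w => w ∘ p) du; rewrite compBl comp0m => e.
  by apply: (zlin1 e); rewrite compBl -!compA; zmod.
- by exists (bp_prl B ∘ (u ∘ p)).
- move=> Q EQ c x e.
  have [|w [uw _]] := uU Q (bp_inl B ∘ c + bp_inr B ∘ x).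
    by rewrite compBl -!compA bp_prl_pair bp_prr_pair -e; zmod.
  have [y py] := pP Q EQ w; exists y.
  by rewrite -!compA py uw bp_prl_pair bp_prr_pair.
Qed.

Lemma resolution_exists : bounded_above A X ->
  exists (P : complex A) (r : chain_map P X),
    [/\ bounded_above A P, forall n, E (P n) & test_qis E r].
Proof.
move=> [N X0]; have [Z Z0] := zero_object A.
pose z n : stage n := Stage (0 : hom Z (X n)) (idm Z).
have to0 T (u v : hom T Z) : u = v.
  by have [H _] := Z0 T; rewrite (H u) (H v).
have from0 T (u v : hom Z T) : u = v.
  by have [_ H] := Z0 T; rewrite (H u) (H v).
have z_link (n : int) : N <= n -> stage_link (z (n + 1)) (z n).
  move=> le_Nn; split; first exact: E_zero.
  exists 0; split=> /=.
  - split=> [|T t _]; first exact: to0.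
    by exists t; split=> [|u _]; apply: to0.
  - exact: from0.
  - by exists 0; apply: to0.
  - move=> Q EQ c x _; exists 0; split; first exact: to0.
    by have [H _] := X0 n le_Nn Q; rewrite (H x) (H (_ ∘ _)).
have [s [sz sR]] := int_descend z_link stage_step.
have [d dP] : exists d : forall n, hom (st_obj (s n)) (st_obj (s (n + 1))),
    forall n, stage_diff (s (n + 1)) (s n) (d n).
  exists (fun n => sval (boolp.cid (proj2 (sR n)))) => n.
  by case: boolp.cid.
have dd (n : int) : d (n + 1) ∘ d n = 0.
  have [[k0 _] _ _ _] := dP (n + 1); have [_ _ [e ->] _] := dP n.
  by rewrite compA k0 comp0m.
pose P := Complex dd.
have rc (n : int) : st_map (s (n + 1)) ∘ cd P n = cd X n ∘ st_map (s n).
  by have [_ -> _ _] := dP n.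
exists P, (ChainMap rc); split.
- by exists N => n le_Nn /=; rewrite sz.
- by move=> n; have [] := sR n.
split=> Q EQ n x dx /=; have [[k0 kU] _ _ _] := dP (n + 1).
  move=> [y dy]; have [c [ec _]] := kU Q x dx; rewrite -ec in dy.
  have [_ _ _ H] := dP n; have [w [dw _]] := H Q EQ c y (esym dy).
  by exists w; rewrite -ec.
(* Surjectivity is the case [c = 0] of the last clause: cycles lift exactly, not merely up to a
   boundary. *)
have [_ _ _ H] := dP (n + 1).
have [|y [dy ry]] := H Q EQ 0 x; first by rewrite dx !compm0.
exists y; split; first by rewrite /= dy compm0.
by exists 0; rewrite ry subrr compm0.
Qed.

End Resolution.

(** * Closure properties and tests for acyclicity *)

Lemma biproduct_zero (A : additive_category) (X Y : A)
    (B : biproduct_data (@idm A) (@comp A) X Y) :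
  is_zero X -> is_zero Y -> is_zero (bp_obj B).
Proof.
move=> X0 Y0 T; split=> f.
  apply: bp_prP; rewrite compm0.
    by have [H _] := X0 T; apply: H.
  by have [H _] := Y0 T; apply: H.
rewrite -[f]compm1 -(bp_id B) compDr !compA.
have [_ HX] := X0 T; have [_ HY] := Y0 T.
by rewrite (HX (f ∘ _)) (HY (f ∘ _)) !comp0m addr0.
Qed.

Lemma cone_bounded_above (A : additive_category) (X Y : complex A)
    (s : chain_map X Y) :
  bounded_above A X -> bounded_above A Y -> bounded_above A (cone s).
Proof.
move=> [N X0] [M Y0]; exists (Num.max N M) => n.
rewrite ge_max => /andP[le_Nn le_Mn]; apply: biproduct_zero; last exact: Y0.
by apply: X0; apply: le_trans le_Nn _; rewrite lerDl.
Qed.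

Section PureProjective.
Variables (lam : small) (A : additive_category).

Lemma lpure_projective_zero (Z : A) : is_zero Z -> lpure_projective lam Z.
Proof.
move=> Z0 X Y W f g _ h; exists 0; rewrite compm0.
by have [_ H] := Z0 W; rewrite (H h).
Qed.

Lemma lpure_projective_biproduct (X Y : A)
    (B : biproduct_data (@idm A) (@comp A) X Y) :
  lpure_projective lam X -> lpure_projective lam Y ->
  lpure_projective lam (bp_obj B).
Proof.
move=> PX PY U V W f g fg h.
have [x gx] := PX _ _ _ f g fg (h ∘ bp_inl B).
have [y gy] := PY _ _ _ f g fg (h ∘ bp_inr B).
exists (x ∘ bp_prl B + y ∘ bp_prr B).
by rewrite compDr !compA gx gy -!compA -compDr bp_id compm1.
Qed.

Lemma lpure_projective_coproduct (I : small) (X : I -> A) S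
    (c : forall i, hom (X i) S) :
  is_coproduct c -> (forall i, lpure_projective lam (X i)) ->
  lpure_projective lam S.
Proof.
move=> cS PX U V W f g fg h.
have [x gx] : exists x : forall i, hom (X i) V, forall i, g ∘ x i = h ∘ c i.
  exists (fun i => sval (boolp.cid (PX i _ _ _ f g fg (h ∘ c i)))) => i.
  by case: boolp.cid.
have [y [yc _]] := cS V x; exists y.
have [w [_ wU]] := cS W (fun i => h ∘ c i).
by rewrite -(wU h) // (wU (g ∘ y)) // => i; rewrite -compA yc gx.
Qed.

Lemma projective_lpure_projective (P : A) :
  projective P -> lpure_projective lam P.
Proof.
move=> projP V V' W f g [[[gf _] [_ cokg]] _]; apply: projP => T t t' e.
have tg0 : t ∘ g ∘ f = 0 by rewrite -compA gf compm0.
have [v [_ vU]] := cokg T (t ∘ g) tg0.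
by rewrite -(vU t erefl) -(vU t' (esym e)).
Qed.

End PureProjective.

Lemma acyclic_test (A : additive_category) (X : K A) :
  acyclic A X -> test_acyclic (@projective A) X.
Proof.
move=> H P projP n x dx; have [U [k [u [[k0 kU] epi_u e]]]] := H n.
have [v [kv _]] := kU P x dx; have [y uy] := projP _ _ u epi_u v.
by exists y; rewrite e -compA uy.
Qed.

(** An epimorphism from a projective onto the kernel factors through the comparison map [u], which
    is therefore epi. *)
Lemma test_acyclic_acyclic (A : additive_category) (X : K A) :
  is_abelian A -> enough_projectives A -> test_acyclic (@projective A) X ->
  acyclic A X.
Proof.
move=> [kers _ _ _] enough H n.
have [U [k [k0 kU]]] := kers _ _ (cd X (n + 1)).
have [u [ku _]] := kU _ (cd X n) (cdd X n).
exists U, k, u; split=> //; have [P [p [projP epi_p]]] := enough U.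
have [|y dy] := H P projP n (k ∘ p); first by rewrite compA k0 comp0m.
have uy : u ∘ y = p.
  have kp0 : cd X (n + 1) ∘ (k ∘ p) = 0 by rewrite compA k0 comp0m.
  have [v [_ vU]] := kU P (k ∘ p) kp0.
  by rewrite -(vU p erefl) -(vU (u ∘ y)) // compA ku.
by move=> T t t' e; apply: epi_p; rewrite -uy !compA e.
Qed.

Lemma K_dist_cone (A : additive_category) (X Y Z : K A) (f : chom X Y)
    (g : chom Y Z) (h : chom Z (shift X)) :
  dist f g h ->
  exists (X' Y' : K A) (f' : chom X' Y') (a : chom X X') (b : chom Y Y')
    (c : chom Z (cone f' : K A)),
    [/\ is_iso a, is_iso b & is_iso c] /\
    [/\ b ⊙ f ≈ f' ⊙ a,
        c ⊙ g ≈ (cone_inj f' : chom Y' (cone f' : K A)) ⊙ b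
      & fmap shift a ⊙ h ≈
        (cone_proj f' : chom (cone f' : K A) (shift X')) ⊙ c].
Proof.
move=> d; have [X' [Y' [f' i]]] : K_dist f g h by exact: d.
by exists X', Y', f'; exact: i.
Qed.

(** [cone_in_class] is formed inside [full B], so every new vertex, including that of the cone of
    [c], has to be shown to lie in [B]. *)
Lemma full_triangle_resolution (T : tri_category) (B P L : subclass T) :
  (forall (X Y Z : T) (f : chom X Y) (g : chom Y Z) (h : chom Z (shift X))
      (X0 Y0 : T) (a : chom X0 X) (b : chom Y0 Y) (p : chom X0 Y0),
    B Z -> B X0 -> B Y0 -> P X0 -> P Y0 -> dist f g h ->
    cone_in_class L a -> cone_in_class L b -> b ⊙ p ≈ f ⊙ a ->
    exists (Z0 : T) (g0 : chom Y0 Z0) (h0 : chom Z0 (shift X0)) (c : chom Z0 Z),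
      [/\ B Z0 /\ P Z0, dist p g0 h0,
          exists (W : T) (u : chom Z W) (v : chom W (shift Z0)),
            [/\ dist c u v, L W & B W],
          c ⊙ g0 ≈ g ⊙ b & fmap shift a ⊙ h0 ≈ h ⊙ c]) ->
  forall (X Y Z : full B) (f : chom X Y) (g : chom Y Z) (h : chom Z (shift X))
      (X0 Y0 : full B) (a : chom X0 X) (b : chom Y0 Y) (p : chom X0 Y0),
    dist f g h -> restr B P X0 -> restr B P Y0 ->
    cone_in_class (restr B L) a -> cone_in_class (restr B L) b ->
    b ⊙ p ≈ f ⊙ a ->
    exists (Z0 : full B) (g0 : chom Y0 Z0) (h0 : chom Z0 (shift X0))
      (c : chom Z0 Z),
      [/\ restr B P Z0, dist p g0 h0, cone_in_class (restr B L) c,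
          c ⊙ g0 ≈ g ⊙ b & fmap shift a ⊙ h0 ≈ h ⊙ c].
Proof.
move=> H X Y Z f g h X0 Y0 a b p d PX0 PY0 /full_cone La /full_cone Lb e.
have [Z0 [g0 [h0 [c [[BZ0 PZ0] d0 [W [u [v [dc LW BW]]]] e1 e2]]]]] :=
  H (sval X) (sval Y) (sval Z) f g h (sval X0) (sval Y0) a b p (svalP Z)
    (svalP X0) (svalP Y0) PX0 PY0 d La Lb e.
exists (exist _ Z0 BZ0), g0, h0, c; split=> //.
by exists (exist _ W BW), u, v.
Qed.

(** * Pure acyclic cones of bounded above complexes *)

Section Kminus.
Variables (lam : small) (A : additive_category).
Let PP : A -> Prop := lpure_projective lam (A:=A).

(** Up to isomorphisms in the homotopy category, [s] is a chain map [f'] whose actual cone is pure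
    acyclic. *)
Lemma cone_in_class_test_qis (X Y : K A) (s : chom X Y) :
  cone_in_class (lpure_acyclic lam A) s -> test_qis PP (s : chain_map X Y).
Proof.
case=> Z [g [h [/K_dist_cone[X' [Y' [f' [a [b [c i]]]]]] Zac]]].
have [[ia ib ic] [e1 _ _]] := i.
have [c' [c'c cc']] := ic; have ic' : is_iso c' by exists c.
have qf : test_qis PP f'.
  exact: cone_test_qis (test_qis_acyclic (test_qis_iso PP ic') Zac).
have [b' [b'b bb']] := ib; have ib' : is_iso b' by exists b.
have qfa := test_qis_comp qf (test_qis_iso PP ia).
have := test_qis_comp (test_qis_iso PP ib')
  (test_qis_homotopic (ceq_sym e1) qfa).
apply: test_qis_homotopic.
exact: ceq_trans (ccompA b' b s) (ceq_trans (ccomp_eql s b'b) (ccomp1m s)).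
Qed.

Lemma test_qis_cone_in_class (X Y : Kminus A) (s : chom X Y) :
  test_qis PP (s : chain_map (sval X) (sval Y)) ->
  cone_in_class (lam_Kminus lam A) s.
Proof.
move=> qs; have bc := cone_bounded_above s (svalP X) (svalP Y).
exists (exist _ (cone s) bc), (cone_inj s), (cone_proj s); split.
  exists (sval X), (sval Y), s; apply: tri_iso_eq; exact: ceq_refl.
exact: test_qis_cone qs.
Qed.

Lemma cone_in_class_local (X Y : Kminus A) (s : chom X Y) :
  cone_in_class (lam_Kminus lam A) s -> local (PP_Kminus lam A) s.
Proof.
move=> /full_cone/cone_in_class_test_qis/test_qis_cone qs Q PQ.
exact: cone_null_local (svalP Q) PQ qs.
Qed.

Lemma K_triangle_resolution (X Y Z : K A) (f : chom X Y) (g : chom Y Z)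
    (h : chom Z (shift X)) (X0 Y0 : K A) (a : chom X0 X) (b : chom Y0 Y)
    (p : chom X0 Y0) :
  dist f g h -> test_qis PP a -> test_qis PP b -> b ⊙ p ≈ f ⊙ a ->
  exists c : chom (cone p : K A) Z,
    [/\ test_qis PP c,
        c ⊙ (cone_inj p : chom Y0 (cone p : K A)) ≈ g ⊙ b
      & fmap shift a ⊙ (cone_proj p : chom (cone p : K A) (shift X0)) ≈ h ⊙ c].
Proof.
move=> /K_dist_cone[X' [Y' [f' [u [v [w i]]]]]] qa qb e.
have [[iu iv iw] [e1 e2 e3]] := i.
have e' : (v ⊙ b) ⊙ p ≈ f' ⊙ (u ⊙ a) by apply: square_paste e e1.
(* The pasted square commutes in the homotopy category; the homotopy witnessing this is the datum
   [k] of [cone_map]. *)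
have [k ek] := e'.
pose c' : chom (cone p : K A) (cone f' : K A) := cone_map ek.
have qc' : test_qis PP (cone_map ek).
  by apply: cone_map_test_qis; apply: test_qis_comp => //; apply: test_qis_iso.
have [w' [w'w ww']] := iw; have iw' : is_iso w' by exists w.
exists (w' ⊙ c'); split.
- by apply: test_qis_comp => //; apply: test_qis_iso.
- apply: (iso_cancel_l iw); rewrite !ccompA ww' ccomp1m e2 -ccompA.
  apply: eq_homotopic => n; apply: cone_ext.
    by rewrite cone_map_fst !coneE compm0 comp0m.
  by rewrite cone_map_snd !coneE compm0 compm1 comp1m addr0.
- apply: (iso_cancel_l (fmap_is_iso (@shift (K A)) iu)).
  rewrite !ccompA e3 -fmap_comp -(ccompA _ w w') ww' ccompm1.
  apply: eq_homotopic => n; rewrite /=.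
  by have := @cone_map_fst A _ _ _ _ p f' (chain_comp u a) (chain_comp v b) k
    n _ (idm (cone p n)); rewrite compm1 /cone_fst compm1 => ->.
Qed.

Lemma Kminus_triangle_resolution (X Y Z : Kminus A) (f : chom X Y)
    (g : chom Y Z) (h : chom Z (shift X)) (X0 Y0 : Kminus A) (a : chom X0 X)
    (b : chom Y0 Y) (p : chom X0 Y0) :
  dist f g h -> PP_Kminus lam A X0 -> PP_Kminus lam A Y0 ->
  cone_in_class (lam_Kminus lam A) a -> cone_in_class (lam_Kminus lam A) b ->
  b ⊙ p ≈ f ⊙ a ->
  exists (Z0 : Kminus A) (g0 : chom Y0 Z0) (h0 : chom Z0 (shift X0))
    (c : chom Z0 Z),
    [/\ PP_Kminus lam A Z0, dist p g0 h0, cone_in_class (lam_Kminus lam A) c,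
        c ⊙ g0 ≈ g ⊙ b & fmap shift a ⊙ h0 ≈ h ⊙ c].
Proof.
move: X Y Z f g h X0 Y0 a b p; apply: full_triangle_resolution.
move=> X Y Z f g h X0 Y0 a b p bZ bX0 bY0 PX0 PY0 d La Lb e.
have [c [qc e1 e2]] := K_triangle_resolution d (cone_in_class_test_qis La)
  (cone_in_class_test_qis Lb) e.
have bc := cone_bounded_above p bX0 bY0.
exists (cone p), (cone_inj p), (cone_proj p), c; split=> //.
- by split=> // n; apply: lpure_projective_biproduct.
- exists X0, Y0, p; apply: tri_iso_eq; exact: ceq_refl.
- exists (cone c), (cone_inj c), (cone_proj c); split.
  + exists (cone p), Z, c; apply: tri_iso_eq; exact: ceq_refl.
  + exact: test_qis_cone.
  + exact: cone_bounded_above.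
Qed.

End Kminus.

Lemma full_isomorphic (T : tri_category) (B : subclass T) (X Y : full B) :
  isomorphic X Y -> @isomorphic T (sval X) (sval Y).
Proof. by []. Qed.

(** * The equivalences, granted pure projective precovers *)

Section Assembly.
Variables (lam : small) (A : additive_category).
Hypothesis A_abelian : is_abelian A.
Hypothesis A_projectives : enough_projectives A.
Hypothesis A_precovers : precovering (fun P : A => lpure_projective lam P).

Lemma Kminus_resolution (X : Kminus A) :
  exists (Q : Kminus A) (r : chom Q X),
    PP_Kminus lam A Q /\ cone_in_class (lam_Kminus lam A) r.
Proof.
have [kers _ _ _] := A_abelian.
have [P [r [bP PP qr]]] := resolution_exists kers (@lpure_projective_zero lam A)
  A_precovers (svalP X).
exists (exist _ P bP), r; split=> //.
exact: test_qis_cone_in_class.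
Qed.

Lemma acyclic_pullback (X Y : K A) (s : chom X Y) :
  test_qis (@projective A) (s : chain_map X Y) -> acyclic A Y -> acyclic A X.
Proof.
move=> qs /acyclic_test Yac; apply: test_acyclic_acyclic => //.
exact: test_qis_acyclic qs Yac.
Qed.

(** Projectives are pure projective, so a map with pure acyclic cone is also a quasi-isomorphism as
    tested on projectives. *)
Lemma ac_Kminus_pullback (X Y : Kminus A) (s : chom X Y) :
  cone_in_class (lam_Kminus lam A) s -> ac_Kminus A Y -> ac_Kminus A X.
Proof.
move=> /full_cone/cone_in_class_test_qis [si ss].
apply: (@acyclic_pullback (sval X) (sval Y) s).
by split=> Q projQ; [apply: si | apply: ss]; apply: projective_lpure_projective.
Qed.

Lemma ac_Kminus_isomorphic (X Y : Kminus A) :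
  isomorphic X Y -> ac_Kminus A Y -> ac_Kminus A X.
Proof.
move=> /full_isomorphic[s is_s]; apply: acyclic_pullback.
exact: test_qis_iso is_s.
Qed.

Lemma lam_Kminus_ac_Kminus (X : Kminus A) :
  lam_Kminus lam A X -> ac_Kminus A X.
Proof. exact: lpure_acyclic_acyclic. Qed.

Lemma pure_derived_equivalences :
  tri_equivalent (Kminus_ac_PP lam A) (verdier (lam_Kminus_ac lam A)) /\
  tri_equivalent (Dminus A) (verdier (ac_Kminus_PP lam A)) /\
  tri_equivalent (verdier (ac_Kminus_PP lam A))
                 (verdier (ac_PP_Dminus_lam lam A)).
Proof.
split; [|split].
- exact: (restr_equivalent Kminus_resolution (@cone_in_class_local lam A)
    (@Kminus_triangle_resolution lam A)
    lam_Kminus_ac_Kminus ac_Kminus_pullback).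
- exact: (verdier_res_equivalent Kminus_resolution (@cone_in_class_local lam A)
    (@Kminus_triangle_resolution lam A)
    lam_Kminus_ac_Kminus ac_Kminus_pullback).
- exact: (verdier_ess_image_equivalent Kminus_resolution
    (@cone_in_class_local lam A) (@Kminus_triangle_resolution lam A)
    ac_Kminus_pullback ac_Kminus_isomorphic).
Qed.

End Assembly.

(** * Pure projective precovers *)

Section Cardinals.
Local Open Scope classical_set_scope.
Local Open Scope card_scope.

Lemma card_le_lt_trans (T U V : Type) (A : set T) (B : set U) (C : set V) :
  A #<= B -> card_lt B C -> card_lt A C.
Proof.
move=> AB [BC CB]; split; first exact: card_le_trans AB BC.
by move=> CA; apply: CB; apply: card_le_trans CA AB.
Qed.

Lemma finite_card_lt (T U : Type) (A : set T) (B : set U) :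
  finite_set A -> infinite_set B -> card_lt A B.
Proof.
move=> fA iB; split; last by move=> BA; apply: iB; apply: card_le_finite fA.
have [n An] := (finite_set_leP A).1 fA; apply: (card_le_trans An).
exact: card_le_trans (card_leT _) ((infiniteP B).1 iB).
Qed.

(** The union is covered by the image of the disjoint sum, to which regularity applies. *)
Lemma regular_bigcup (lam T : small) (S : set (set T)) :
  infinite_regular lam -> card_lt S [set: lam] ->
  (forall B, S B -> card_lt B [set: lam]) ->
  card_lt (\bigcup_(B in S) B) [set: lam].
Proof.
move=> [_ reg] S_lt B_lt.
pose F (j : set_type S) : small := set_type (set_val j).
pose f (p : {j & F j}) : T := set_val (projT2 p).
apply: (card_le_lt_trans _ (reg (set_type S) F _ _)).
- apply: card_le_trans (card_image_le f [set: _]).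
  apply: subset_card_le => x [B SB Bx].
  by exists (existT _ (SigSub (mem_set SB)) (SigSub (mem_set Bx))).
- apply: card_le_lt_trans S_lt; have := card_setT S.
  by rewrite card_eq_le => /andP[].
- move=> j; apply: card_le_lt_trans (B_lt _ (set_valP j)).
  by have := card_setT (set_val j); rewrite card_eq_le => /andP[].
Qed.

End Cardinals.

(** * Presentable objects as quotients of one coproduct *)

Section Presentable.
Variables (lam : small) (A : additive_category).
Hypothesis lam_regular : infinite_regular lam.
Hypothesis cokernels : forall (X Y : A) (f : hom X Y),
  exists C (c : hom Y C), is_cokernel f c.
Hypothesis coproducts : has_coproducts A.
Variable G : A.
Hypothesis G_generator : is_generator G.
Local Open Scope classical_set_scope.

Lemma generator0 (X Y : A) (f : hom X Y) :
  (forall x : hom G X, f ∘ x = 0) -> f = 0.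
Proof.
move=> fx; have [//|nf] := pselect (f = 0).
by have [x []] := G_generator nf; rewrite fx comp0m.
Qed.

(** The quotient of [F] by the images of all [x i] is the cokernel of the map they induce from a
    coproduct. *)
Lemma family_cokernel (I : small) (X : I -> A) (F : A)
    (x : forall i, hom (X i) F) :
  exists Q (q : hom F Q), (forall i, q ∘ x i = 0) /\
    forall T (t : hom F T), (forall i, t ∘ x i = 0) ->
    exists! u : hom Q T, u ∘ q = t.
Proof.
have [S [c cS]] := coproducts X; have [y [yc _]] := cS F x.
have [Q [q [qy qU]]] := cokernels y; exists Q, q; split=> [i|T t tx].
  by rewrite -yc compA qy comp0m.
apply: qU; have [w [_ wU]] := cS T (fun=> 0).
rewrite -(wU (t ∘ y)) ?(wU 0) // => i; first by rewrite comp0m.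
by rewrite -compA yc tx.
Qed.

Section SmallGeneration.
Variable F : A.
Let H : small := hom G F.

Let is_small (B : set H) : Prop := card_lt B [set: lam].
Let small_set := {B : set H | is_small B}.
Let le (B C : small_set) : Prop := sval B `<=` sval C.

Let Q_sig (B : small_set) : {Q : A & {q : hom F Q |
  (forall x, sval B x -> q ∘ x = 0) /\
  forall T (t : hom F T), (forall x, sval B x -> t ∘ x = 0) ->
    exists! u : hom Q T, u ∘ q = t}}.
Proof.
have [Q /boolp.cid[q [q0 qU]]] := boolp.cid
  (family_cokernel (fun x : set_type (sval B) => set_val x : hom G F)).
exists Q, q; split=> [x Bx|T t tx]; first exact: (q0 (SigSub (mem_set Bx))).
by apply: qU => -[x Bx]; apply: tx; apply: set_mem.
Qed.

Let Q B := projT1 (Q_sig B).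
Let q B : hom F (Q B) := sval (projT2 (Q_sig B)).
Let q0 B (x : hom G F) : sval B x -> q B ∘ x = 0.
Proof. exact: (svalP (projT2 (Q_sig B))).1. Qed.
Let qU B T (t : hom F T) : (forall x, sval B x -> t ∘ x = 0) ->
  exists! u : hom (Q B) T, u ∘ q B = t.
Proof. exact: (svalP (projT2 (Q_sig B))).2. Qed.

Let q_epi B : epi (q B).
Proof.
move=> T u v e; have [|w [_ wU]] := qU (B := B) (t := u ∘ q B).
  by move=> x Bx; rewrite -compA q0 // compm0.
by rewrite -(wU u) // (wU v).
Qed.

Let trans_sig B C (BC : le B C) : {m : hom (Q B) (Q C) | m ∘ q B = q C}.
Proof.
have [|m [mq _]] := boolp.cid (qU (B := B) (t := q C) _); last by exists m.
by move=> x Bx; apply: q0; apply: BC.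
Qed.
Let trans B C (BC : le B C) := sval (trans_sig BC).
Let transE B C (BC : le B C) : trans BC ∘ q B = q C.
Proof. exact: svalP (trans_sig BC). Qed.

Let D : diagram A le.
Proof.
refine (@Diagram A small_set le Q trans _ _).
- by move=> B BB; apply: (@q_epi B); rewrite transE comp1m.
- by move=> B C E BC CE BE; apply: (@q_epi B); rewrite -compA !transE.
Defined.

Let le_poset : is_poset le.
Proof.
split=> [B x //|B C E BC CE x /BC/CE //|[B hB] [C hC] BC CB].
by apply: eq_exist; apply/seteqP; split.
Qed.

Let le_directed : lam_directed lam le.
Proof.
split=> // S S_lt; have union_lt : card_lt
    (\bigcup_(B in [set sval B | B in S]) B) [set: lam].
  apply: regular_bigcup => //.
    exact: card_le_lt_trans (card_image_le _ _) S_lt.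
  by move=> _ [B _ <-]; exact: (svalP B).
exists (exist is_small _ union_lt) => B SB x Bx.
by exists (sval B) => //; exists B.
Qed.

Let finite_small (B : set H) : finite_set B -> card_lt B [set: lam].
Proof. by move=> fB; apply: finite_card_lt fB lam_regular.1. Qed.

(** Each [x : G -> F] is killed in the quotient by [{x}], so every cocone vanishes on all maps from
    the generator. *)
Let colimit_zero Z (Z0 : is_zero Z) :
  @is_colimit A small_set le D Z (fun B => 0).
Proof.
split=> [B C BC|T t tC]; first by rewrite comp0m.
have t0 B : t B = 0.
  apply: (@q_epi B); rewrite comp0m; apply: generator0 => x.
  pose Cx : small_set :=
    exist is_small [set (x : H)] (finite_small (finite_set1 _)).
  have [E leE] := le_directed.2 [set B; Cx]
    (finite_card_lt (finite_set2 _ _) lam_regular.1).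
  have BE : le B E by apply: leE; left.
  have CE : le Cx E by apply: leE; right.
  have tE B' (BE' : le B' E) : t B' ∘ q B' = t E ∘ q E.
    by rewrite -(tC _ _ BE') -compA; congr (_ ∘ _); apply: transE.
  by rewrite (tE _ BE) -(tE _ CE) -compA q0 ?compm0.
exists 0; split=> [B|u _]; first by rewrite comp0m t0.
by have [_ HZ] := Z0 T; rewrite (HZ u).
Qed.

Lemma lpresentable_small_generated : lpresentable lam F ->
  exists2 B : set H, card_lt B [set: lam] &
    forall T (t : hom F T), (forall x, B x -> t ∘ x = 0) -> t = 0.
Proof.
move=> presF; have [Z Z0] := zero_object A.
have [_ colim] := presF _ _ le_directed D _ _ (colimit_zero Z0).
(* Being killed at a later stage is a cocone with values in [Prop], so it factors through Hom(F, Z).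
   There [q B0] and zero have the same image; zero is killed, hence so is [q B0]. *)
pose t (B : small_set) (y : hom F (Q B)) : Prop :=
  exists C (BC : le B C), trans BC ∘ y = 0.
have [|u [ut _]] := colim Prop t.
  move=> B C BC y; apply/propext; split=> -[E [CE e]].
    have BE : le B E by move=> x /BC/CE.
    by exists E, BE; rewrite -[trans BE](dg_comp D BC CE BE) -compA.
  have [E' leE] := le_directed.2 [set C; E]
    (finite_card_lt (finite_set2 _ _) lam_regular.1).
  have CE' : le C E' by apply: leE; left.
  have EE' : le E E' by apply: leE; right.
  have BE' : le B E' by move=> x /BC/CE'.
  exists E', CE'; rewrite compA (dg_comp D BC CE' BE').
  by rewrite -(dg_comp D CE EE' BE') -compA e compm0.
pose B0 : small_set := exist is_small set0 (finite_small (finite_set0 _)).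
have : t B0 (q B0).
  rewrite -ut comp0m -[X in u X](comp0m _ (0 : hom F (Q B0))) ut.
  by exists B0, (fun x p => p); rewrite compm0.
move=> [C [BC]]; rewrite transE => qC0; exists (sval C); first exact: (svalP C).
by move=> T s s0; have [v [<- _]] := qU s0; rewrite qC0 compm0.
Qed.

End SmallGeneration.
Lemma lpresentable_quotient (S : A) (c : lam -> hom G S) (F : A) :
  is_coproduct c -> lpresentable lam F -> exists e : hom S F, epi e.
Proof.
move=> cS /lpresentable_small_generated[B [/card_subP[C CB _] _] BF].
have /card_bijP[f [g fK gK]] := CB.
have [x xB] : exists x : lam -> hom G F, forall b, B b -> exists l, x l = b.
  (* [C] is a copy of [B] inside [lam]; indices outside it are sent to the zero map. *)
  exists (fun l => if pselect (C l) is left Cl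
    then set_val (f (SigSub (mem_set Cl))) : hom G F else 0) => b Bb.
  exists (set_val (g (SigSub (mem_set Bb)))).
  case: pselect => [Cl|[]]; last first.
    exact: set_valP.
  have -> : SigSub (mem_set Cl) = g (SigSub (mem_set Bb)) by apply: val_inj.
  by rewrite gK.
have [e [ec _]] := cS F x; exists e => T u v uv.
apply/eqP; rewrite -subr_eq0; apply/eqP; apply: BF => b /xB[l <-].
by rewrite -ec compA compBl uv subrr comp0m.
Qed.

Hypothesis kernels : forall (X Y : A) (f : hom X Y),
  exists K (k : hom K X), is_kernel f k.
Hypothesis epi_cokernel : forall (X Y : A) (f : hom X Y), epi f ->
  exists Z (g : hom Z X), is_cokernel g f.

Lemma epi_is_cokernel (X Y K : A) (f : hom X Y) (k : hom K X) :
  epi f -> is_kernel f k -> is_cokernel k f.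
Proof.
move=> /epi_cokernel[Z [g [fg gU]]] [fk kU]; split=> // T t tk.
have [v [kv _]] := kU _ g fg.
by apply: gU; rewrite -kv compA tk comp0m.
Qed.

(* An epimorphism out of [S] is determined up to isomorphism by the set of maps
   [G -> S] it kills. *)
Lemma epi_factor (S X Y : A) (e : hom S X) (f : hom S Y) :
  epi e -> (forall u : hom G S, e ∘ u = 0 -> f ∘ u = 0) ->
  exists i : hom X Y, i ∘ e = f.
Proof.
move=> epi_e ef; have [K [k kk]] := kernels e.
have [ek _] := kk; have [_ eU] := epi_is_cokernel epi_e kk.
have [|i [ie _]] := eU Y f; last by exists i.
apply: generator0 => u; rewrite -compA; apply: ef.
by rewrite compA ek comp0m.
Qed.

Lemma lpresentable_small : exists (J : small) (F : J -> A),
  (forall j, lpure_projective lam (F j)) /\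
  forall X, lpresentable lam X ->
    exists j (i : hom (F j) X) (r : hom X (F j)), i ∘ r = idm X.
Proof.
have [S [c cS]] := coproducts (fun _ : lam => G).
pose good (j : set (hom G S)) (X : A) := lpresentable lam X /\
  exists2 e : hom S X, epi e & forall u, e ∘ u = 0 <-> j u.
have [Z Z0] := zero_object A.
have [F FP] : {F : set (hom G S) -> A & forall j,
    lpure_projective lam (F j) /\ ((exists X, good j X) -> good j (F j))}.
  apply: (@choice _ _ (fun j X => lpure_projective lam X /\
    ((exists X', good j X') -> good j X))) => j.
  (* Subsets not arising from a presentable quotient get the zero object, which keeps every [F j]
     pure projective. *)
  have [[X gX]|nX] := pselect (exists X, good j X); last first.
    by exists Z; split=> //; apply: lpure_projective_zero.
  by exists X; split=> //; apply: lpresentable_pure_projective gX.1.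
exists (set (hom G S)), F; split=> [j|X presX]; first exact: (FP j).1.
have [e epi_e] := lpresentable_quotient cS presX.
pose j : set (hom G S) := fun u => e ∘ u = 0.
have [_ [|_ [e' epi_e' e'j]]] := FP j; first by exists X; split=> //; exists e.
have [i ie] := epi_factor epi_e' (fun u => (e'j u).1).
have [r re] := epi_factor epi_e (fun u => (e'j u).2).
exists j, i, r; apply: epi_e; by rewrite -compA re ie comp1m.
Qed.

(** The kernel sequence of [p] is shown to be pure exact, so every pure projective lifts along
    [p]. *)
Lemma lpure_projective_precovering : enough_projectives A ->
  precovering (fun P : A => lpure_projective lam P).
Proof.
move=> enough X; have [P0 [p0 [projP0 epi_p0]]] := enough X.
have [J [F [PF Fall]]] := lpresentable_small.
have [S [c cS]] := coproducts (fun a : {j : J & hom (F j) X} => F (projT1 a)).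
have [s [sc _]] := cS X (fun a => projT2 a).
pose B := biproduct P0 S.
pose p : hom (bp_obj B) X := p0 ∘ bp_prl B + s ∘ bp_prr B.
have PB : lpure_projective lam (bp_obj B).
  apply: lpure_projective_biproduct; first exact: projective_lpure_projective.
  by apply: lpure_projective_coproduct cS _ => a; apply: PF.
have epi_p : epi p.
  have pl : p ∘ bp_inl B = p0.
    by rewrite compDl -!compA bp_ll bp_rl compm0 addr0 compm1.
  by move=> T u v e; apply: epi_p0; rewrite -pl !compA e.
have [K [k kp]] := kernels p.
have pure_p : lpure lam k p.
  split=> [|Y presY]; first by split=> //; apply: epi_is_cokernel.
  have [pk kU] := kp; split=> [x kx|y|y].
  - have [|v [_ vU]] := kU _ (0 : hom Y (bp_obj B)); first exact: compm0.
    by rewrite -(vU x kx) (vU 0) // compm0.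
  - split=> [py|[x <-]]; last by rewrite compA pk comp0m.
    by have [x [kx _]] := kU _ y py; exists x.
  - have [j [i [r ir]]] := Fall Y presY.
    (* Since [Y] is a retract of [F j], the map [y] is recovered by [r] from [y ∘ i], which is one
       of the maps indexing the coproduct. *)
    exists (bp_inr B ∘ (c (existT _ j (y ∘ i)) ∘ r)).
    rewrite compDl -!compA ![bp_prl B ∘ _]compA bp_lr comp0m compm0 add0r.
    rewrite [bp_prr B ∘ _]compA bp_rr comp1m compA sc /= -compA ir.
    exact: compm1.
by exists (bp_obj B), p; split=> // Q PQ h; apply: (PQ _ _ _ k p pure_p h).
Qed.

End Presentable.

Theorem theorem3p3 (lam : small) (A : additive_category)
    (lam_regular : infinite_regular lam)
    (A_grothendieck : grothendieck A)
    (A_projectives : enough_projectives A) :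
  tri_equivalent (Kminus_ac_PP lam A) (verdier (lam_Kminus_ac lam A)) /\
  tri_equivalent (Dminus A) (verdier (ac_Kminus_PP lam A)) /\
  tri_equivalent (verdier (ac_Kminus_PP lam A))
                 (verdier (ac_PP_Dminus_lam lam A)).
Proof.
have [A_abelian coproducts _ [G G_generator]] := A_grothendieck.
have [kernels cokernels _ epi_cokernel] := A_abelian.
exact: (pure_derived_equivalences A_abelian A_projectives
  (lpure_projective_precovering lam_regular cokernels coproducts G_generator
     kernels epi_cokernel A_projectives)).
Qed.
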